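(* Let $G=(V,E)$ be a connected undirected $(D,c)$-uniform graph with $n=|V|$ vertices and $\delta$-mixing time $T(n)$ for $\delta=\frac{1}{(2cn)^2}$; assume $T(n)$ stays bounded as $n\to\infty$ and the minimum degree $D$ grows with $n$. Let $A$ be the $m\times|E|$ measurement matrix generated by $m=O(T(n)k\log n)$ independent ''good start'' regularized random walks of length $t=O(|E|/k)$. Then with probability $1-o(1)$, $\ell_1$ minimization, i.e. solving $\min \|\tilde{\mathbf{x}}\|_1$ subject to $A\tilde{\mathbf{x}}=A\mathbf{x}$, recovers every $\Theta(k)$-sparse edge vector $\mathbf{x}\in\mathbb{R}^{E}$ exactly.
   Context: An undirected graph is $(D,c)$-uniform if every vertex has degree between $D$ and $cD$. A standard random walk moves at each step to a uniformly random neighbor; its stationary distribution is $\mu(v)=d_v/(2|E|)$. The $\delta$-mixing time is the smallest $t'$ such that for every starting vertex the distribution $\mu'$ after $t'$ steps satisfies $\|\mu-\mu'\|_\infty\le\delta$. A ''good start'' random walk of length $t$ starts at vertex $v$ with probability $d_v/(2|E|)$ and then performs $t$ steps of the standard random walk. A regularized walk adapted from a walk $W$ is a walk traversing exactly the same set of edges as $W$ but traversing each such edge at most twice (such a walk always exists). The measurement matrix has rows indexed by the walks and columns by the edges of $G$; its $(i,j)$ entry is the number of times the $i$-th regularized walk traverses edge $j$ (so entries lie in $\{0,1,2\}$). A vector is $s$-sparse if it has at most $s$ nonzero entries. *)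

(* Defs.v *)
From HB Require Import structures.
From mathcomp Require Import all_boot all_order all_algebra.
From mathcomp Require Import boolp reals exp.
Set Implicit Arguments. Unset Strict Implicit. Unset Printing Implicit Defensive.
Import Order.TTheory GRing.Theory Num.Theory.
Local Open Scope ring_scope.

Section Graph.
Variables (R : realType) (n : nat) (adj : rel 'I_n).

Definition simple_graph := symmetric adj /\ irreflexive adj.
Definition connected_graph := forall u v : 'I_n, connect adj u v.

Definition deg (v : 'I_n) : nat := #|[pred w | adj v w]|.

Definition uniform_graph (D c : R) :=
  forall v : 'I_n, D <= (deg v)%:R /\ (deg v)%:R <= c * D.

(* edges: unordered pairs {u,v}, represented as (u,v) with u < v *)
Definition edge_pred : pred ('I_n * 'I_n) := fun p => adj p.1 p.2 && (p.1 < p.2)%N.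
Definition edge := {p : 'I_n * 'I_n | edge_pred p}.
HB.instance Definition _ := Finite.on edge.

Definition nedges : nat := #|{: edge}|.

Definition stat (v : 'I_n) : R := (deg v)%:R / (2 * (nedges%:R)).
Definition trans (u v : 'I_n) : R := (adj u v)%:R / (deg u)%:R.

Fixpoint walk_dist (t : nat) (v0 u : 'I_n) : R :=
  match t with
  | 0 => (u == v0)%:R
  | t'.+1 => \sum_(w : 'I_n) walk_dist t' v0 w * trans w u
  end.

Definition mixes (delta : R) (t : nat) :=
  forall v0 u : 'I_n, `|stat u - walk_dist t v0 u| <= delta.

Definition is_mixing_time (delta : R) (T : nat) :=
  mixes delta T /\ forall t, (t < T)%N -> ~ mixes delta t.

Definition is_walk (s : seq 'I_n) : bool :=
  if s is x :: s' then path adj x s' else true.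

Definition traversals (s : seq 'I_n) (e : edge) : nat :=
  count (fun p : 'I_n * 'I_n =>
           ((p.1 == (val e).1) && (p.2 == (val e).2)) ||
           ((p.1 == (val e).2) && (p.2 == (val e).1)))
        (zip s (behead s)).

Definition regularization (reg : seq 'I_n -> seq 'I_n) :=
  forall s, is_walk s ->
    is_walk (reg s) /\
    forall e : edge, ((0 < traversals (reg s) e)%N = (0 < traversals s e)%N)
                     /\ (traversals (reg s) e <= 2)%N.

(* probability of a vertex sequence under a "good start" random walk *)
Definition walk_weight (s : seq 'I_n) : R :=
  if s is x :: s' then stat x * \prod_(p <- zip s s') trans p.1 p.2 else 0.

Definition l1norm (x : edge -> R) : R := \sum_(e : edge) `|x e|.

Definition l1_recovers (m : nat) (A : 'I_m -> edge -> R) (s : R) :=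
  forall x : edge -> R, (#|[pred e | x e != 0]|%:R <= s) ->
  forall y : edge -> R,
    (forall i : 'I_m, \sum_(e : edge) A i e * y e = \sum_(e : edge) A i e * x e) ->
    (exists e, y e != x e) -> l1norm x < l1norm y.

Definition meas_matrix (reg : seq 'I_n -> seq 'I_n) (m t : nat)
  (ws : {ffun 'I_m -> (t.+1).-tuple 'I_n}) : 'I_m -> edge -> R :=
  fun i e => (traversals (reg (ws i)) e)%:R.

Definition success_prob (reg : seq 'I_n -> seq 'I_n) (m t : nat) (s : R) : R :=
  \sum_(ws : {ffun 'I_m -> (t.+1).-tuple 'I_n} |
          `[< l1_recovers (meas_matrix reg ws) s >])
     \prod_(i < m) walk_weight (ws i).

End Graph.

(* Main.v *)
Require Import Defs.
From HB Require Import structures.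
From mathcomp Require Import all_boot all_order all_algebra.
From mathcomp Require Import ring lra zify.
From mathcomp Require Import boolp reals sequences exp.
Set Implicit Arguments. Unset Strict Implicit. Unset Printing Implicit Defensive.
Import Order.TTheory GRing.Theory Num.Theory.
Local Open Scope ring_scope.

(** It suffices to exclude a nonzero [h] in the kernel of the matrix carrying half
    of its l1 mass on at most [beta k] edges.

    Cut [h] into dyadic levels.  At level [tau], consider the walks that traverse an
    edge of value [> tau] and none of value [< - delta tau] (or the same for [- h]).
    The entries of a row are 1 or 2 on the traversed edges, so in the kernel such a
    walk must be compensated by edges of value [>= - delta tau].  Those traversed
    within [B] steps of the large edge are too few and too small, so a share of at
    least [tau / 4] comes from edges traversed at a "far" time.

    - Far coincidences are rare: after [B] steps the walk is almost stationary, and an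
      exponential moment bound together with a union bound over pairs of edge sets
      shows that the total far mass is at most a small multiple [eps] of
      [m t |h|_1 / |E|].
    - The selected walks are frequent: by reversibility, a stationary walk seen from
      one of its vertices consists of two independent walks with the same law.  In each
      of them some step dominates, up to a constant depending on [B], all later ones;
      two independent dominating steps have the same sign with positive probability
      unless one of them beats the whole other half.  Hence the expected total level
      of the selected walks is at least [eta t |h|_1 / |E|], and a Chernoff bound with a
      union bound over pairs of edge sets makes this uniform in [h].

    Choosing [eps] small against [eta] gives a contradiction. *)

(** * Expectations along the random walk *)

Section EdgeLabels.
Variables (R : realType) (n : nat) (adj : rel 'I_n).
Hypothesis adj_simple : simple_graph adj.

(** An option, since non-adjacent pairs carry no edge. Labels forget the orientation of a step, so
    reversing a walk merely reverses its label sequence. *)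
Definition edge_label (u v : 'I_n) : option (edge adj) :=
  [pick e : edge adj | (val e == (u, v)) || (val e == (v, u))].

Lemma edge_labelC u v : edge_label u v = edge_label v u.
Proof. by rewrite /edge_label; apply: eq_pick => e; rewrite orbC. Qed.

Lemma val_edge (e : edge adj) : adj (val e).1 (val e).2 /\ ((val e).1 < (val e).2)%N.
Proof. by case: e => p /=; rewrite /edge_pred => /andP[]. Qed.

Lemma edge_labelE (u v : 'I_n) (e : edge adj) :
  (edge_label u v == Some e) = (val e == (u, v)) || (val e == (v, u)).
Proof.
rewrite /edge_label; case: pickP => [e' he'|/(_ e) /= -> //].
apply/eqP/idP => [[<-] //|he].
congr Some; apply: val_inj; apply/eqP.
have [_ h1] := val_edge e; have [_ h2] := val_edge e'.
case/orP: he he' h1 h2 => /eqP -> /orP[] /eqP -> //=; lia.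
Qed.

Lemma edge_label_fst_snd (e : edge adj) : edge_label (val e).1 (val e).2 = Some e.
Proof. by apply/eqP; rewrite edge_labelE -surjective_pairing eqxx. Qed.

(** Every edge is seen once from each endpoint: the pairs with [u < v] enumerate the edges, symmetry
    gives the other half, and irreflexivity kills the diagonal. *)
Lemma sum_edge_label (phi : option (edge adj) -> R) :
  \sum_(u : 'I_n) \sum_(v : 'I_n) (adj u v)%:R * phi (edge_label u v) = 2 * \sum_(e : edge adj) phi (Some e).
Proof.
have half : \sum_(u : 'I_n) \sum_(v : 'I_n | (u < v)%N) (adj u v)%:R * phi (edge_label u v) =
            \sum_(e : edge adj) phi (Some e).
  rewrite pair_big_dep /=.
  rewrite (bigID (fun p : 'I_n * 'I_n => adj p.1 p.2)) /= [X in _ + X]big1 ?addr0; last first.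
    by move=> p /andP[_ /negbTE ->]; rewrite mul0r.
  rewrite (eq_bigl (fun p => p \in [pred p | edge_pred adj p])); last first.
    by move=> p; rewrite !inE /edge_pred andbC.
  rewrite big_sub; apply: eq_bigr => e _.
  have [h _] := val_edge e.
  by rewrite (edge_label_fst_snd e) h mul1r.
under eq_bigr => u _ do rewrite (bigID (fun v : 'I_n => (u < v)%N)) /=.
rewrite big_split /= half mulr2n mulrDl mul1r; congr (_ + _).
rewrite -half (exchange_big_dep predT) //= [RHS](eq_bigr (fun u : 'I_n => \sum_(v : 'I_n | (u < v)%N)
  (adj v u)%:R * phi (edge_label v u))); last first.
  by move=> u _; apply: eq_bigr => v _; rewrite edge_labelC adj_simple.1.
apply: eq_bigr => u _.
rewrite (bigID (fun v : 'I_n => (u < v)%N)) /= [X in _ + X]big1 ?addr0; last first.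
  move=> v /andP[h1 h2]; have /val_inj -> : val u = val v by rewrite /=; lia.
  by rewrite adj_simple.2 mul0r.
by apply: eq_bigl => v; lia.
Qed.


Lemma sum_deg : \sum_(v : 'I_n) (deg adj v)%:R = 2 * (nedges adj)%:R :> R.
Proof.
have := sum_edge_label (fun=> 1).
rewrite sumr_const => <-; apply: eq_bigr => v _.
rewrite /deg -sum1_card natr_sum big_mkcond; apply: eq_bigr => u _ /=.
by rewrite inE mulr1; case: adj.
Qed.

(** Regularization preserves which traversal counts are positive, so this lets the support of a
    matrix row be read off the labels of the original walk. *)
Lemma mem_pairmap_edge_label x s (e : edge adj) :
  (Some e \in pairmap edge_label x s) = (0 < traversals (x :: s) e)%N.
Proof.
rewrite /traversals -has_count /=.
elim: s x => [//|y s IH] x /=.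
rewrite inE IH; congr orb.
rewrite eq_sym edge_labelE [val e]surjective_pairing !xpair_eqE /=.
by rewrite !(eq_sym (sval e).1) !(eq_sym (sval e).2) [X in _ || X = _]andbC.
Qed.

Hypothesis deg_gt0 : forall v, (0 < deg adj v)%N.

Local Notation trans := (@trans R n adj).
Local Notation stat := (@stat R n adj).

Lemma trans_ge0 u v : 0 <= trans u v.
Proof. by rewrite /Defs.trans divr_ge0. Qed.

Lemma stat_ge0 u : 0 <= stat u.
Proof. by rewrite /Defs.stat divr_ge0 // mulr_ge0. Qed.

Lemma deg_neq0 v : (deg adj v)%:R != 0 :> R.
Proof. by rewrite pnatr_eq0 -lt0n. Qed.

Lemma sum_trans u : \sum_v trans u v = 1.
Proof.
rewrite /Defs.trans -mulr_suml (_ : \sum_v _ = (deg adj u)%:R) ?divff ?deg_neq0 //.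
rewrite /deg -sum1_card natr_sum [RHS]big_mkcond; apply: eq_bigr => v _ /=.
by rewrite inE; case: adj.
Qed.

Lemma detailed_balance u v : stat u * trans u v = stat v * trans v u.
Proof.
rewrite /Defs.stat /Defs.trans (adj_simple.1 u v).
(* Without edges, division by zero makes both sides 0. *)
have := deg_neq0 u; have := deg_neq0 v; have [->|h] := eqVneq ((nedges adj)%:R : R) 0.
  by rewrite mulr0 invr0 !mulr0 !mul0r.
by move=> hv hu; field; rewrite h hv hu.
Qed.

Lemma stat_trans u v : stat u * trans u v = (adj u v)%:R / (2 * (nedges adj)%:R).
Proof.
rewrite /Defs.stat /Defs.trans mulrC mulrA divfK ?deg_neq0 //.
Qed.

(* Expected value of [f] on the sequence of edges traversed by an [l]-step
   random walk started at [v]. *)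
Fixpoint walkE (l : nat) (v : 'I_n) (f : seq (option (edge adj)) -> R) : R :=
  if l is l'.+1 then
    \sum_u trans v u * walkE l' u (fun s => f (edge_label v u :: s))
  else f [::].

Definition statE (l : nat) (f : seq (option (edge adj)) -> R) : R :=
  \sum_v stat v * walkE l v f.

Lemma eq_walkE l v f g : (forall s, size s = l -> f s = g s) -> walkE l v f = walkE l v g.
Proof.
elim: l v f g => [|l IH] v f g h /=; first exact: h.
by apply: eq_bigr => u _; congr (_ * _); apply: IH => s hs; rewrite h //= hs.
Qed.

Lemma ler_walkE l v f g : (forall s, size s = l -> f s <= g s) -> walkE l v f <= walkE l v g.
Proof.
elim: l v f g => [|l IH] v f g h /=; first exact: h.
apply: ler_sum => u _; rewrite ler_wpM2l ?trans_ge0 //.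
by apply: IH => s hs; rewrite h //= hs.
Qed.

Lemma walkE_cst l v (a : R) : walkE l v (fun=> a) = a.
Proof.
elim: l v => [|l IH] v //=.
by under eq_bigr => u _ do rewrite IH; rewrite -mulr_suml sum_trans mul1r.
Qed.

Lemma walkE_sum (I : Type) (r : seq I) (P : pred I) l v (f : I -> seq (option (edge adj)) -> R) :
  walkE l v (fun s => \sum_(i <- r | P i) f i s) = \sum_(i <- r | P i) walkE l v (f i).
Proof.
elim: l v f => [|l IH] v f //=.
by under eq_bigr => u _ do rewrite IH mulr_sumr; rewrite exchange_big.
Qed.

Lemma walkED l v f g : walkE l v (fun s => f s + g s) = walkE l v f + walkE l v g.
Proof.
elim: l v f g => [|l IH] v f g //=.
by under eq_bigr => u _ do rewrite IH mulrDr; rewrite big_split.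
Qed.

Lemma walkEZ l v a f : walkE l v (fun s => a * f s) = a * walkE l v f.
Proof.
elim: l v f => [|l IH] v f //=.
by rewrite mulr_sumr; apply: eq_bigr => u _; rewrite IH mulrCA.
Qed.

Lemma walkE_ge0 l v f : (forall s, size s = l -> 0 <= f s) -> 0 <= walkE l v f.
Proof. by move=> h; rewrite -[X in X <= _](walkE_cst l v); apply: ler_walkE. Qed.

Lemma walkE_exchange l1 v1 l2 v2 f :
  walkE l1 v1 (fun s1 => walkE l2 v2 (fun s2 => f s1 s2)) =
  walkE l2 v2 (fun s2 => walkE l1 v1 (fun s1 => f s1 s2)).
Proof.
elim: l1 v1 f => [|l1 IH] v1 f //=.
rewrite walkE_sum; apply: eq_bigr => u _.
by rewrite walkEZ IH.
Qed.

Lemma walkE_take l1 l2 v f : walkE (l1 + l2) v (fun s => f (take l1 s)) = walkE l1 v f.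
Proof.
elim: l1 v f => [|l1 IH] v f /=.
  by under eq_walkE => s _ do rewrite take0; rewrite walkE_cst.
by apply: eq_bigr => u _; rewrite -(IH _ (fun s => f (_ :: s))).
Qed.

(* Reversibility: seen from its [p]-th vertex, a stationary walk consists of two
   independent walks, one of them run backwards. *)
Lemma statE_split p l f :
  statE (p + l) f =
  \sum_v stat v * walkE p v (fun s1 => walkE l v (fun s2 => f (rev s1 ++ s2))).
Proof.
elim: p l => [|p IH] l /=; first by apply: eq_bigr.
(* The induction hypothesis cuts one vertex earlier; detailed balance then moves the first forward
   step to the backward half. *)
rewrite addSnnS IH /=.
under eq_bigr => v _ do rewrite walkE_sum mulr_sumr.
under [RHS]eq_bigr => v _ do rewrite mulr_sumr.
rewrite exchange_big; apply: eq_bigr => u _; apply: eq_bigr => v _ /=.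
rewrite walkEZ [LHS]mulrA [RHS]mulrA detailed_balance; congr (_ * _).
by apply: eq_walkE => s1 _; apply: eq_walkE => s2 _; rewrite rev_cons cat_rcons edge_labelC.
Qed.

(** Stationarity: in the split form the backward half is exactly what gets dropped, and it
    integrates to 1. *)
Lemma statE_drop p l f : statE (p + l) (fun s => f (drop p s)) = statE l f.
Proof.
rewrite statE_split; apply: eq_bigr => v _; congr (_ * _).
rewrite -[RHS](walkE_cst p v); apply: eq_walkE => s1 h1; apply: eq_walkE => s2 _.
by rewrite drop_size_cat // size_rev.
Qed.

End EdgeLabels.

(** * Transfer operators and mixing *)

Section Transfer.
Variables (R : realType) (n : nat) (adj : rel 'I_n).
Hypothesis adj_simple : simple_graph adj.
Hypothesis deg_gt0 : forall v, (0 < deg adj v)%N.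

Local Notation label := (option (edge adj)).
Local Notation trans := (@trans R n adj).
Local Notation stat := (@stat R n adj).
Local Notation el := (@edge_label n adj).
Local Notation E := ((nedges adj)%:R : R).

Definition label_in (F : {set edge adj}) (o : label) : bool :=
  if o is Some e then e \in F else false.

(** All ordered adjacent pairs have the same mass by [stat_trans], so one stationary step traverses
    a uniformly random edge. *)
Lemma statE_step (phi : label -> R) :
  \sum_v stat v * (\sum_u trans v u * phi (el v u)) = (\sum_e phi (Some e)) / E.
Proof.
under eq_bigr => v _ do rewrite mulr_sumr.
transitivity ((\sum_(u : 'I_n) \sum_(v : 'I_n) (adj u v)%:R * phi (el u v)) / (2 * E)).
  rewrite mulr_suml; apply: eq_bigr => v _; rewrite mulr_suml; apply: eq_bigr => u _.
  by rewrite [LHS]mulrA stat_trans // mulrAC.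
by rewrite sum_edge_label // invfM mulrACA divff ?mul1r ?pnatr_eq0.
Qed.

Lemma sum_label_in (F : {set edge adj}) :
  \sum_(e : edge adj) (label_in F (Some e))%:R = #|F|%:R :> R.
Proof.
rewrite -sum1_card natr_sum big_mkcond [RHS]big_mkcond.
by apply: eq_bigr => e _ /=; case: (e \in F).
Qed.

(** A composition of weighted transition operators applied to [G]. By [walkE_transfer] it computes
    the expectation of a product of weights on successive steps; the operator form allows bounds to
    be composed block by block. *)
Fixpoint transfer (phis : seq (label -> R)) (G : 'I_n -> R) (v : 'I_n) : R :=
  if phis is phi :: phis' then
    \sum_u trans v u * (phi (el v u) * transfer phis' G u)
  else G v.

Lemma transfer_cat phis psis G : transfer (phis ++ psis) G =1 transfer phis (transfer psis G).
Proof.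
elim: phis => [|phi phis IH] v //=.
by apply: eq_bigr => u _; rewrite IH.
Qed.

Lemma walkE_transfer phis v :
  walkE (size phis) v (fun s => \prod_(p <- zip phis s) p.1 p.2) = transfer phis (fun=> 1) v.
Proof.
elim: phis v => [|phi phis IH] v /=; first by rewrite big_nil.
apply: eq_bigr => u _; congr (_ * _).
by under eq_walkE => s _ do rewrite big_cons /=; rewrite walkEZ IH.
Qed.

(** Nonnegativity is carried along because multiplying the inequalities needs it. The default
    [fun=> 0] makes the hypothesis trivial beyond the end of the lists. *)
Lemma ler_transfer phis psis G H v : size phis = size psis ->
  (forall i o, 0 <= nth (fun=> 0) phis i o <= nth (fun=> 0) psis i o) ->
  (forall u, 0 <= G u <= H u) ->
  0 <= transfer phis G v <= transfer psis H v.
Proof.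
elim: phis psis v => [|phi phis IH] [|psi psis] //= v [hs] h hG.
have h0 o : 0 <= phi o <= psi o := h 0%N o.
have hI u : 0 <= transfer phis G u <= transfer psis H u.
  by apply: IH => // i o; exact: (h i.+1 o).
apply/andP; split.
  apply: sumr_ge0 => u _; rewrite mulr_ge0 ?trans_ge0 // mulr_ge0 //.
    by case/andP: (h0 (el v u)).
  by case/andP: (hI u).
apply: ler_sum => u _; rewrite ler_wpM2l ?trans_ge0 //.
case/andP: (h0 (el v u)) => a1 a2; case/andP: (hI u) => b1 b2.
exact: ler_pM.
Qed.

Lemma nth_nseq_le (phi psi : label -> R) k i o : (forall o, 0 <= phi o <= psi o) ->
  0 <= nth (fun=> 0) (nseq k phi) i o <= nth (fun=> 0) (nseq k psi) i o.
Proof. by move=> h; rewrite !nth_nseq; case: ifP => // _; rewrite lexx. Qed.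

Lemma transferZ phis a G v : transfer phis (fun u => a * G u) v = a * transfer phis G v.
Proof.
elim: phis v => [|phi phis IH] v //=.
rewrite mulr_sumr; apply: eq_bigr => u _; rewrite IH; ring.
Qed.

Lemma eq_transfer phis G H : G =1 H -> transfer phis G =1 transfer phis H.
Proof.
move=> h; elim: phis => [|phi phis IH] v //=.
by apply: eq_bigr => u _; rewrite IH.
Qed.

Definition one_label (o : label) : R := 1.
Local Notation steps k := (nseq k one_label).

Lemma steps_cst k a v : transfer (steps k) (fun=> a) v = a.
Proof.
elim: k v => [|k IH] v //=.
under eq_bigr => u _ do rewrite IH mul1r.
by rewrite -mulr_suml sum_trans // mul1r.
Qed.

Lemma ler_steps k G H v : (forall u, 0 <= G u <= H u) ->
  transfer (steps k) G v <= transfer (steps k) H v.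
Proof.
move=> h; suff /andP[] : 0 <= transfer (steps k) G v <= transfer (steps k) H v by [].
by apply: ler_transfer => // i o; apply: nth_nseq_le => o'; rewrite ler01 lexx.
Qed.

(** [walk_dist] peels off the last step while [transfer] peels off the first; this reconciles the
    two recursions. *)
Lemma walk_distSl j v u :
  walk_dist R adj j.+1 v u = \sum_w trans v w * walk_dist R adj j w u.
Proof.
elim: j v u => [|j IH] v u.
  rewrite /= (bigD1 v) //= eqxx mul1r big1 ?addr0; last first.
    by move=> w /negbTE ->; rewrite mul0r.
  rewrite (bigD1 u) //= eqxx mulr1 big1 ?addr0 // => w hw.
  by rewrite eq_sym (negbTE hw) mulr0.
rewrite -[LHS]/(\sum_w walk_dist R adj j.+1 v w * trans w u).
under eq_bigr => w _ do rewrite IH mulr_suml.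
rewrite exchange_big; apply: eq_bigr => w _.
by rewrite /= mulr_sumr; apply: eq_bigr => x _; rewrite -mulrA.
Qed.

Lemma steps_walk_dist k G v : transfer (steps k) G v = \sum_w walk_dist R adj k v w * G w.
Proof.
elim: k v => [|k IH] v.
  rewrite /= (bigD1 v) //= eqxx mul1r big1 ?addr0 //.
  by move=> w /negbTE ->; rewrite mul0r.
under [RHS]eq_bigr => w _ do rewrite walk_distSl mulr_suml.
rewrite exchange_big /=; apply: eq_bigr => w _.
rewrite mul1r IH mulr_sumr; apply: eq_bigr => x _; ring.
Qed.

Definition hit_prob (F : {set edge adj}) (v : 'I_n) : R :=
  \sum_u trans v u * (label_in F (el v u))%:R.

Lemma hit_prob_ge0 F v : 0 <= hit_prob F v.
Proof. by apply: sumr_ge0 => u _; rewrite mulr_ge0 ?trans_ge0. Qed.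

Lemma hit_prob_le1 F v : hit_prob F v <= 1.
Proof.
rewrite -(sum_trans R deg_gt0 v); apply: ler_sum => u _.
by rewrite ler_piMr ?trans_ge0 //; case: label_in.
Qed.

Lemma walkE_hit l j v F : (j < l)%N ->
  walkE l v (fun s => (label_in F (nth None s j))%:R) = transfer (steps j) (hit_prob F) v.
Proof.
elim: l j v => [//|l IH] [|j] v h /=.
  by apply: eq_bigr => u _; rewrite walkE_cst.
by apply: eq_bigr => u _; rewrite IH // mul1r.
Qed.

Lemma stat_hit_prob F : \sum_v stat v * hit_prob F v = #|F|%:R / E.
Proof. by rewrite (statE_step (fun o => (label_in F o)%:R)) sum_label_in. Qed.

(** Detailed balance turns an incoming step into an outgoing one, whose probabilities sum to 1. *)
Lemma stat_steps j G : \sum_v stat v * transfer (steps j) G v = \sum_v stat v * G v.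
Proof.
elim: j => [//|j IH] /=.
under eq_bigr => v _ do rewrite mulr_sumr.
rewrite exchange_big -IH; apply: eq_bigr => u _ /=.
rewrite -[RHS]mulr1 -(sum_trans R deg_gt0 u) mulr_sumr; apply: eq_bigr => v _.
by rewrite mul1r [LHS]mulrA detailed_balance // mulrAC.
Qed.

(** * Exponential weights on the visits to a small edge set *)

Section Mixing.
Variables (B : nat).
Hypothesis mixing : forall k v F, (B <= k)%N ->
  transfer (steps k) (hit_prob F) v <= 2 * #|F|%:R / E.

Variables (t : nat) (F : {set edge adj}).
Hypothesis small_F : 2 * t%:R * #|F|%:R <= E.

Let c : R := (4 * B.+1%:R)^-1.
(** Multiplied along a walk, these weights give [1 + c] to the number of visits to [F]. The value of
    [c] is chosen so that [B.+1] expected visits cost at most a factor 2. *)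
Definition boost (o : label) : R := 1 + c * (label_in F o)%:R.

Let c_gt0 : 0 < c. Proof. by rewrite invr_gt0 mulr_gt0. Qed.
Let cB : c * B.+1%:R = 4^-1.
Proof. by rewrite /c invfM mulfVK // pnatr_eq0. Qed.

Lemma boost_ge1 o : 1 <= boost o.
Proof. by rewrite lerDl mulr_ge0 // ltW. Qed.

Lemma boost_le o : boost o <= 1 + c.
Proof. by rewrite lerD2l; case: label_in; rewrite ?mulr1 ?mulr0 // ltW. Qed.

Lemma boost_pow j : (j <= B)%N -> (1 + c) ^+ j <= 2.
Proof.
move=> hj.
(* A reverse Bernoulli inequality, stable under induction as long as [c * i] stays below 1/4. *)
have aux i : (i <= B)%N -> (1 + c) ^+ i <= 1 + 2 * c * i%:R.
  elim: i => [|i IH] hi; first by rewrite expr0 mulr0 addr0.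
  have {}IH := IH (ltnW hi).
  have ci : c * i%:R <= 4^-1 by rewrite -cB ler_pM2l // ler_nat; lia.
  have i0 : 0 <= c * i%:R by rewrite mulr_ge0 // ltW.
  rewrite exprSr; apply: (@le_trans _ _ ((1 + 2 * c * i%:R) * (1 + c))).
    by rewrite ler_wpM2r // addr_ge0 // ltW // c_gt0.
  rewrite -[i.+1%:R]natr1; move: c_gt0 ci i0; nra.
have := aux j hj.
have : c * j%:R <= 4^-1 by rewrite -cB ler_pM2l // ler_nat; lia.
by move=> *; nra.
Qed.

Lemma sum_lt_le l : (\sum_(j < l) (j < B) <= B)%N.
Proof.
suff -> : (\sum_(j < l) (j < B) = minn l B)%N by rewrite geq_minr.
elim: l => [|l IH]; first by rewrite big_ord0 min0n.
by rewrite big_ord_recr /= IH; lia.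
Qed.

(** The first [B] steps contribute at most 1 each; every later one contributes at most [2 |F| / E]
    by mixing, hence at most 1 altogether by [small_F]. *)
Lemma sum_hit l v : (l <= t)%N ->
  \sum_(j < l) transfer (steps j) (hit_prob F) v <= B.+1%:R.
Proof.
move=> hl.
have E0 : 0 <= 2 * #|F|%:R / E by rewrite divr_ge0 ?mulr_ge0.
apply: (@le_trans _ _ (\sum_(j < l) ((j < B)%:R + 2 * #|F|%:R / E))).
  apply: ler_sum => j _; case: ltnP => hj.
    apply: (@le_trans _ _ 1); last by rewrite lerDl.
    rewrite -[leRHS](steps_cst j 1 v); apply: ler_steps => u.
    by rewrite hit_prob_ge0 hit_prob_le1.
  by rewrite add0r; exact: mixing.
rewrite big_split /= -natr_sum sumr_const card_ord -[B.+1%:R]natr1 lerD //.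
  by rewrite ler_nat sum_lt_le.
have [->|E1] := eqVneq E 0; first by rewrite invr0 mulr0 mul0rn.
rewrite -[leLHS]mulr_natr mulrAC ler_pdivrMr ?mul1r ?lt0r ?E1 ?ler0n //.
by apply: le_trans small_F; rewrite mulrAC ler_wpM2r // ler_wpM2l // ler_nat.
Qed.

(** A bootstrap: expanding the first weight, the extra term is at most [2 c] on [F] because shorter
    walks already obey the bound 2. The total is then at most 1 plus [2 c] times the expected number
    of visits, which is 3/2 by [sum_hit]. *)
Lemma boost_le2 l v : (l <= t)%N -> transfer (nseq l boost) (fun=> 1) v <= 2.
Proof.
have aux k u : (k <= t)%N -> transfer (nseq k boost) (fun=> 1) u <=
    1 + 2 * c * \sum_(j < k) transfer (steps j) (hit_prob F) u ->
    transfer (nseq k boost) (fun=> 1) u <= 2.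
  move=> hk /le_trans; apply.
  have := sum_hit u hk.
  have := c_gt0; move: (\sum_(j < k) _) cB => x h1 h2 h3; nra.
move=> hl; apply: (aux l v) => //; elim: l v hl => [|l IH] v hl.
  by rewrite big_ord0 mulr0 addr0.
have {}IH u := IH u (ltnW hl).
have I2 u : transfer (nseq l boost) (fun=> 1) u <= 2 by apply: (aux l u) (IH u); exact: ltnW.
rewrite big_ord_recl /=.
apply: (@le_trans _ _ (\sum_u trans v u *
  (1 + 2 * c * (\sum_(j < l) transfer (steps j) (hit_prob F) u) +
   2 * c * (label_in F (el v u))%:R))).
  apply: ler_sum => u _; rewrite ler_wpM2l ?trans_ge0 //.
  rewrite /boost mulrDl mul1r lerD //.
  by rewrite [2 * c]mulrC -!mulrA ler_wpM2l ?(ltW c_gt0) // mulrC ler_wpM2r.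
pose S u := \sum_(j < l) transfer (steps j) (hit_prob F) u.
rewrite (eq_bigr (fun u => trans v u + 2 * c * (trans v u * S u) +
    2 * c * (trans v u * (label_in F (el v u))%:R))); last first.
  by move=> u _; rewrite -/(S u); ring.
rewrite !big_split /= sum_trans // -addrA lerD2l mulrDr addrC -!mulr_sumr lerD2l.
rewrite ler_wpM2l ?mulr_ge0 ?(ltW c_gt0) //.
rewrite (eq_bigr (fun u => \sum_(j < l) trans v u * transfer (steps j) (hit_prob F) u)); last first.
  by move=> u _; rewrite mulr_sumr.
rewrite exchange_big; apply: ler_sum => j _ /=.
by apply: ler_sum => u _; rewrite mul1r.
Qed.

Lemma transfer_ge0 phis G v : (forall i o, 0 <= nth (fun=> 0) phis i o) ->
  (forall u, 0 <= G u) -> 0 <= transfer phis G v.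
Proof.
move=> h1 h2; suff /andP[] : 0 <= transfer phis G v <= transfer phis G v by [].
by apply: ler_transfer => // [i o|u]; rewrite lexx ?h1 ?h2.
Qed.

Lemma nseq_boost_ge0 k i o : 0 <= nth (fun=> 0) (nseq k boost) i o.
Proof. by rewrite nth_nseq; case: ifP => // _; apply: le_trans (boost_ge1 o). Qed.

Lemma boost_near k G u : (k <= B)%N -> (forall w, 0 <= G w) ->
  transfer (nseq k boost) G u <= 2 * transfer (steps k) G u.
Proof.
move=> hk G0.
have /andP[h0 h1] : 0 <= transfer (nseq k boost) G u <= transfer (nseq k (fun=> 1 + c)) G u.
  apply: ler_transfer => //; first by rewrite !size_nseq.
    move=> i o; apply: nth_nseq_le => o'; rewrite boost_le andbT.
    exact: le_trans (boost_ge1 o').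
  by move=> w; rewrite G0 lexx.
apply: (le_trans h1).
have -> : forall j, transfer (nseq j (fun=> 1 + c)) G u = (1 + c) ^+ j * transfer (steps j) G u.
  move=> j; elim: j u {h0 h1} => [|j IH] u /=; first by rewrite expr0 mul1r.
  by rewrite mulr_sumr; apply: eq_bigr => w _; rewrite IH exprS mul1r; ring.
rewrite ler_wpM2r ?boost_pow // transfer_ge0 // => i o.
by rewrite nth_nseq; case: ifP => // _; exact: ler01.
Qed.

(** The last [B] steps mix, and their weights cost a factor 2 by [boost_near]; the weights before
    them cost another factor 2 by [boost_le2]. *)
Lemma boost_far k v Y : (B <= k <= t)%N ->
  transfer (nseq k boost) (hit_prob Y) v <= 8 * #|Y|%:R / E.
Proof.
move=> /andP[hk hkt].
have near u : 0 <= transfer (nseq B boost) (hit_prob Y) u <= 4 * #|Y|%:R / E.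
  rewrite transfer_ge0 /=; [|exact: nseq_boost_ge0|exact: hit_prob_ge0].
  apply: (le_trans (boost_near _ (leqnn B) (hit_prob_ge0 Y))).
  rewrite (_ : 4 * _ / _ = 2 * (2 * #|Y|%:R / E)); last first.
    by rewrite [RHS]mulrA; congr (_ / _); ring.
  by rewrite ler_wpM2l // mixing.
rewrite -(subnK hk) nseqD transfer_cat.
have /andP[_ h] : 0 <= transfer (nseq (k - B) boost) (transfer (nseq B boost) (hit_prob Y)) v <=
  transfer (nseq (k - B) boost) (fun=> 4 * #|Y|%:R / E * 1) v.
  apply: ler_transfer => // [i o|w]; last by rewrite mulr1.
  by rewrite lexx nseq_boost_ge0.
apply: (le_trans h); rewrite transferZ.
rewrite (_ : 8 * _ / _ = (4 * #|Y|%:R / E) * 2); last by rewrite [RHS]mulrAC; congr (_ / _); ring.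
by rewrite ler_wpM2l ?divr_ge0 ?mulr_ge0 // boost_le2 //; lia.
Qed.

Lemma sum_stat_le1 : \sum_v stat v <= 1.
Proof.
rewrite -mulr_suml sum_deg //; have [->|E1] := eqVneq E 0; first by rewrite mulr0 mul0r.
by rewrite divff // mulf_neq0 // pnatr_eq0.
Qed.

(** A stationary start needs no time to mix, so fewer than [B] steps are covered by [boost_near] and
    invariance. *)
Lemma boost_stat k X : (k <= t)%N ->
  \sum_v stat v * transfer (nseq k boost) (hit_prob X) v <= 8 * #|X|%:R / E.
Proof.
move=> hk; case: (leqP B k) => hB.
  apply: (@le_trans _ _ (\sum_v stat v * (8 * #|X|%:R / E))).
    apply: ler_sum => v _; rewrite ler_wpM2l ?stat_ge0 // boost_far //; lia.
  rewrite -mulr_suml ler_piMl ?sum_stat_le1 // divr_ge0 // mulr_ge0 //.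
apply: (@le_trans _ _ (2 * \sum_v stat v * transfer (steps k) (hit_prob X) v)).
  rewrite mulr_sumr; apply: ler_sum => v _; rewrite mulrCA ler_wpM2l ?stat_ge0 //.
  by apply: boost_near (ltnW hB) _; exact: hit_prob_ge0.
rewrite stat_steps // stat_hit_prob -mulrA ler_wpM2r ?divr_ge0 // ler_nat //.
Qed.

Definition marked (X : {set edge adj}) (o : label) : R := (label_in X o)%:R * boost o.

Lemma transfer_marked X a G v : 0 <= a -> (forall u, 0 <= G u <= a) ->
  0 <= transfer [:: marked X] G v <= 2 * a * hit_prob X v.
Proof.
move=> a0 hG /=; rewrite sumr_ge0 /=; last first.
  move=> u _; rewrite mulr_ge0 ?trans_ge0 // mulr_ge0 ?mulr_ge0 //.
    exact: le_trans (boost_ge1 _).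
  by case/andP: (hG u).
rewrite mulr_sumr; apply: ler_sum => u _; rewrite [leRHS]mulrCA ler_wpM2l ?trans_ge0 //.
have b2 : boost (el v u) <= 2.
  apply: le_trans (boost_le _) _.
  have : 1 <= B.+1%:R :> R by rewrite ler1n.
  have := c_gt0; have := cB; nra.
have b0 := le_trans (@ler01 R) (boost_ge1 (el v u)).
case/andP: (hG u) => g0 ga.
rewrite /marked; case: label_in; last by rewrite !(mul0r, mulr0).
by rewrite mul1r mulr1; apply: ler_pM.
Qed.

(** The operators are bounded from right to left: the tail costs 2, the mark on [Y] another 2, the
    long middle block gives [8 |Y| / E], the mark on [X] costs 2, and the stationary beginning gives
    [8 |X| / E]. The product of the constants is 512. *)
Lemma two_marks a b d X Y : (B <= b)%N -> (a + b + d + 2 = t)%N ->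
  \sum_v stat v * transfer (nseq a boost ++ marked X :: nseq b boost ++ marked Y :: nseq d boost)
     (fun=> 1) v <= 512 * #|X|%:R * #|Y|%:R / E ^+ 2.
Proof.
move=> hb habd.
pose G1 := transfer (nseq d boost) (fun=> 1).
have hG1 u : 0 <= G1 u <= 2.
  rewrite boost_le2 ?andbT; last by lia.
  by apply: transfer_ge0 => // i o; exact: nseq_boost_ge0.
pose G2 := transfer [:: marked Y] G1.
have hG2 u : 0 <= G2 u <= 4 * hit_prob Y u.
  by have := transfer_marked Y u (ler0n R 2) hG1; rewrite -natrM.
pose G3 := transfer (nseq b boost) G2.
have hG3 u : 0 <= G3 u <= 32 * #|Y|%:R / E.
  have /andP[h0 h1] : 0 <= G3 u <= transfer (nseq b boost) (fun u => 4 * hit_prob Y u) u.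
    by apply: ler_transfer => // i o; rewrite lexx nseq_boost_ge0.
  rewrite h0; apply: (le_trans h1); rewrite transferZ.
  rewrite (_ : 32 * _ / _ = 4 * (8 * #|Y|%:R / E)); last first.
    by rewrite [RHS]mulrA; congr (_ / _); ring.
  by rewrite ler_wpM2l // boost_far //; lia.
pose G4 := transfer [:: marked X] G3.
have E0 : 0 <= 32 * #|Y|%:R / E by rewrite divr_ge0 ?mulr_ge0.
have hG4 u : 0 <= G4 u <= 2 * (32 * #|Y|%:R / E) * hit_prob X u.
  exact: transfer_marked.
apply: (@le_trans _ _ (\sum_v stat v * transfer (nseq a boost)
   (fun u => 2 * (32 * #|Y|%:R / E) * hit_prob X u) v)).
  apply: ler_sum => v _; rewrite ler_wpM2l ?stat_ge0 //.
  rewrite transfer_cat.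
  rewrite (@eq_transfer (nseq a boost) _ G4); last first.
    move=> u; rewrite -cat1s; rewrite transfer_cat; apply: eq_transfer => w; rewrite transfer_cat.
    by apply: eq_transfer => z; rewrite -cat1s transfer_cat.
  have /andP[] // : 0 <= transfer (nseq a boost) G4 v <=
     transfer (nseq a boost) (fun u => 2 * (32 * #|Y|%:R / E) * hit_prob X u) v.
  by apply: ler_transfer => // i o; rewrite lexx nseq_boost_ge0.
under eq_bigr => v _ do rewrite transferZ mulrCA.
rewrite -mulr_sumr.
apply: (@le_trans _ _ (2 * (32 * #|Y|%:R / E) * (8 * #|X|%:R / E))).
  by apply: ler_wpM2l; [rewrite mulr_ge0|apply: boost_stat; lia].
by rewrite expr2 invfM le_eqVlt; apply/orP; left; apply/eqP; ring.
Qed.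

End Mixing.
End Transfer.

(** * Far coincidences *)

Section Far.
Variables (R : realType) (n : nat) (adj : rel 'I_n).
Hypothesis adj_simple : simple_graph adj.
Hypothesis deg_gt0 : forall v, (0 < deg adj v)%N.

Local Notation label := (option (edge adj)).
Local Notation trans := (@trans R n adj).
Local Notation stat := (@stat R n adj).
Local Notation el := (@edge_label n adj).
Local Notation E := ((nedges adj)%:R : R).
Local Notation steps k := (nseq k (@one_label R n adj)).

Local Notation statE := (@statE R n adj).
Local Notation walkE := (@walkE R n adj).

Lemma ler_statE l f g : (forall s, size s = l -> f s <= g s) ->
  statE l f <= statE l g :> R.
Proof.
by move=> h; apply: ler_sum => v _; rewrite ler_wpM2l ?stat_ge0 // ler_walkE.
Qed.

Lemma eq_statE l f g : (forall s, size s = l -> f s = g s) ->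
  statE l f = statE l g :> R.
Proof. by move=> h; apply: eq_bigr => v _; congr (_ * _); exact: eq_walkE. Qed.

Lemma statE_sum (I : Type) (r : seq I) (P : pred I) l (f : I -> seq label -> R) :
  statE l (fun s => \sum_(i <- r | P i) f i s) = \sum_(i <- r | P i) statE l (f i).
Proof.
rewrite /statE; under eq_bigr => v _ do rewrite walkE_sum mulr_sumr.
by rewrite exchange_big.
Qed.

Lemma statED l f g : statE l (fun s => f s + g s) = statE l f + statE l g :> R.
Proof. by rewrite -big_split; apply: eq_bigr => v _ /=; rewrite walkED mulrDr. Qed.

Lemma statEZ l a f : statE l (fun s => a * f s) = a * statE l f :> R.
Proof. by rewrite mulr_sumr; apply: eq_bigr => v _ /=; rewrite walkEZ mulrCA. Qed.

Lemma statE_ge0 l f : (forall s, size s = l -> 0 <= f s) -> 0 <= statE l f :> R.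
Proof. by move=> h; apply: sumr_ge0 => v _; rewrite mulr_ge0 ?stat_ge0 // walkE_ge0. Qed.

Lemma statE_cst_le l (a : R) : 0 <= a -> statE l (fun=> a) <= a.
Proof.
move=> a0; rewrite /statE; under eq_bigr => v _ do rewrite walkE_cst //.
by rewrite -mulr_suml ler_piMl // sum_stat_le1.
Qed.

(** The two visits may come in either order, and a single pair of distant visits suffices, even if
    other visits of the same edges are close. *)
Definition far (B : nat) (s : seq label) (e f : edge adj) : bool :=
  [exists p : 'I_(size s), exists q : 'I_(size s),
    [&& ((p + B < q)%N || (q + B < p)%N), nth None s p == Some e & nth None s q == Some f]].

(** It counts edges rather than visits, and is therefore at most the exponent of [1 + c] in the
    product of the weights [boost]. *)
Definition far_count (B : nat) (X F : {set edge adj}) (s : seq label) : nat :=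
  #|[set f in F | [exists e in X, far B s e f]]|.

Lemma card_visited (F : {set edge adj}) (s : seq label) :
  (#|[set f in F | Some f \in s]| <= count (label_in F) s)%N.
Proof.
rewrite -size_filter.
have -> : #|[set f in F | Some f \in s]| = #|(@Some _) @: [set f in F | Some f \in s]|.
  by rewrite card_imset //; move=> ? ? [].
apply: leq_trans (card_size _); apply: subset_leq_card; apply/subsetP => o /imsetP[f].
by rewrite !inE => /andP[h1 h2] ->; rewrite mem_filter h2 /= h1.
Qed.

Lemma far_count_le B X F s : (far_count B X F s <= count (label_in F) s)%N.
Proof.
apply: leq_trans (card_visited F s); apply: subset_leq_card; apply/subsetP => f.
rewrite !inE => /andP[-> /= /existsP[e /andP[_ /existsP[p /existsP[q]]]]].
by case/and3P => _ _ /eqP <-; rewrite mem_nth.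
Qed.

Lemma prod_zip_nseq_cat a (phi : label -> R) psis s : (a <= size s)%N ->
  \prod_(p <- zip (nseq a phi ++ psis) s) p.1 p.2 =
  \prod_(o <- take a s) phi o * \prod_(p <- zip psis (drop a s)) p.1 p.2.
Proof.
elim: a s => [|a IH] [|o s] //=; first by rewrite big_nil mul1r.
- by rewrite big_nil mul1r.
- by move=> h; rewrite !big_cons IH //= mulrA.
Qed.

(** * The exponential moment of the far count *)

Section MGF.
Variables (B : nat).
Hypothesis mixing : forall k v (F : {set edge adj}), (B <= k)%N ->
  transfer (steps k) (hit_prob R F) v <= 2 * #|F|%:R / E.
Variables (t : nat) (F : {set edge adj}).
Hypothesis small_F : 2 * t%:R * #|F|%:R <= E.
Let c : R := (4 * B.+1%:R)^-1.
Let c_gt0 : 0 < c. Proof. by rewrite invr_gt0 mulr_gt0. Qed.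
Local Notation boost := (@boost R n adj B F).
Local Notation marked := (@marked R n adj B F).

Lemma boost_count s : \prod_(o <- s) boost o = (1 + c) ^+ count (label_in F) s.
Proof.
elim: s => [|o s IH]; first by rewrite big_nil.
rewrite big_cons IH /= exprD /boost; congr (_ * _).
by case: (label_in F o); rewrite ?mulr1 ?mulr0 ?addr0.
Qed.

Lemma prod_two_marks a b d X Y s : size s = (a + b + d + 2)%N ->
  \prod_(p <- zip (nseq a boost ++ marked X :: nseq b boost ++
                   marked Y :: nseq d boost) s) p.1 p.2 =
  (label_in X (nth None s a))%:R * (label_in Y (nth None s (a + b).+1))%:R *
  \prod_(o <- s) boost o.
Proof.
move=> hs; rewrite prod_zip_nseq_cat ?hs; last by lia.
rewrite -[in RHS](cat_take_drop a s) big_cat /= !nth_cat !size_take hs.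
have -> : (a < a + b + d + 2)%N by lia.
have -> : ((a + b).+1 < a)%N = false by lia.
rewrite ltnn subnn (_ : ((a + b).+1 - a = b.+1)%N); last by lia.
have : size (drop a s) = (b + d + 2)%N by rewrite size_drop hs; lia.
case: (drop a s) => [|o s']; first by move=> /= h0; exfalso; lia.
move=> /= hs'; rewrite /= !big_cons /=.
have {}hs' : size s' = (b + d + 1)%N by lia.
rewrite prod_zip_nseq_cat ?hs'; last by lia.
rewrite -[in RHS](cat_take_drop b s') big_cat /= !nth_cat !size_take hs'.
have -> : (b < b + d + 1)%N by lia.
rewrite ltnn subnn.
have : size (drop b s') = (d + 1)%N by rewrite size_drop hs'; lia.
case: (drop b s') => [|o' s'']; first by move=> /= h0; exfalso; lia.
move=> /= hs''; rewrite /= !big_cons /= -[nseq d boost]cats0.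
have {}hs'' : size s'' = d by lia.
rewrite prod_zip_nseq_cat ?hs'' // (@take_oversize _ d s'') ?hs'' // (@drop_oversize _ d s'') ?hs'' //=.
rewrite big_nil mulr1.
rewrite /marked; ring.
Qed.

Lemma statE_two_marks p q X Y : (p < t)%N -> (q < t)%N -> (p + B < q)%N ->
  statE t (fun s => (label_in X (nth None s p))%:R * (label_in Y (nth None s q))%:R *
    \prod_(o <- s) boost o) <= 512 * #|X|%:R * #|Y|%:R / E ^+ 2.
Proof.
move=> hp hq hpq.
have hb : (B <= q - p - 1)%N by lia.
have ht : (p + (q - p - 1) + (t - q - 1) + 2 = t)%N by lia.
apply: le_trans (two_marks adj_simple deg_gt0 mixing small_F X Y hb ht).
rewrite le_eqVlt; apply/orP; left; apply/eqP.
apply: eq_bigr => v _; congr (_ * _).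
rewrite -walkE_transfer // size_cat /= size_cat /= !size_nseq.
rewrite (_ : (p + _ = t)%N); last by lia.
apply: eq_walkE => s hs; rewrite prod_two_marks ?ht // (_ : (_ + _).+1 = q) //; lia.
Qed.

(** Either the far count is 0 and the power is 1, or some pair of distant times witnesses a
    coincidence and the power is at most the product of the weights [boost]. Summing
    [statE_two_marks] over the at most [t ^ 2] pairs of times gives the excess over 1. *)
Lemma far_mgf X :
  statE t (fun s => (1 + c) ^+ far_count B X F s) <=
  1 + 512 * t%:R ^+ 2 * #|X|%:R * #|F|%:R / E ^+ 2.
Proof.
have b0 s : 0 <= \prod_(o <- s) boost o.
  by rewrite boost_count exprn_ge0 // addr_ge0 // ltW.
pose term (p q : nat) s : R := ((p + B < q)%N || (q + B < p)%N)%:R *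
  ((label_in X (nth None s p))%:R * (label_in F (nth None s q))%:R * \prod_(o <- s) boost o).
have t0 p q s : 0 <= term p q s by rewrite !mulr_ge0.
apply: (@le_trans _ _ (statE t (fun s => 1 + \sum_(p < t) \sum_(q < t) term p q s))).
  apply: ler_statE => s hs; rewrite /far_count.
  have [h0|[f]] := set_0Vmem [set f in F | [exists e in X, far B s e f]].
    rewrite h0 cards0 expr0 lerDl sumr_ge0 // => p _; exact: sumr_ge0.
  rewrite inE => /andP[fF /existsP[e /andP[eX /existsP[p /existsP[q]]]]].
  case/and3P => hpq /eqP hp /eqP hq.
  have hpt : (p < t)%N by rewrite -hs.
  have hqt : (q < t)%N by rewrite -hs.
  rewrite -/(far_count B X F s) (bigD1 (Ordinal hpt)) //= (bigD1 (Ordinal hqt)) //=.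
  rewrite {1}/term hpq hp hq /= eX fF !mul1r boost_count.
  apply: (@le_trans _ _ ((1 + c) ^+ count (label_in F) s)).
    by rewrite ler_weXn2l ?far_count_le // lerDl ltW.
  rewrite [leRHS]addrC -[leRHS]addrA -[leRHS]addrA lerDl !addr_ge0 //; first by apply: sumr_ge0.
  by apply: sumr_ge0 => p' _; apply: sumr_ge0.
rewrite statED; apply: lerD; first exact: statE_cst_le.
rewrite statE_sum.
apply: (@le_trans _ _ (\sum_(p < t) \sum_(q < t) (512 * #|X|%:R * #|F|%:R / E ^+ 2))).
  apply: ler_sum => p _; rewrite statE_sum; apply: ler_sum => q _.
  rewrite statEZ; case: (boolP ((p + B < q)%N || (q + B < p)%N)) => [|_]; last first.
    by rewrite mul0r divr_ge0 ?mulr_ge0 // exprn_ge0.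
  rewrite mul1r => /orP[] h.
    exact: statE_two_marks.
  (* When the edge of [F] comes first, the two marks exchange their roles while the weights still
     refer to [F]. *)
  apply: le_trans (_ : 512 * #|F|%:R * #|X|%:R / E ^+ 2 <= _); last by rewrite (mulrAC 512).
  apply: le_trans (statE_two_marks F X _ _ h) => //.
  by apply: ler_statE => s _; rewrite [X in X * _]mulrC.
rewrite !sumr_const card_ord -mulrnA -[leLHS]mulr_natr natrM -expr2.
by rewrite le_eqVlt; apply/orP; left; apply/eqP; ring.
Qed.

End MGF.
End Far.

(** * Dominant steps and levels *)

(** Zero terms are skipped; the positive ones decay geometrically, which is why the decay is only
    required after a positive term. *)
Lemma sum_halving (R : realType) (t : nat) (W : nat -> R) (C : R) :
  (forall p, (p < t)%N -> 0 <= W p <= C) ->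
  (forall p q, (p < q < t)%N -> 0 < W p -> 2 * W q <= W p) -> 0 <= C ->
  \sum_(p < t) W p <= 2 * C.
Proof.
elim: t W C => [|t IH] W C h1 h2 C0; first by rewrite big_ord0 mulr_ge0.
rewrite big_ord_recl /=.
have /andP[W0 W0C] := h1 0%N isT.
have [W00|Wpos] := eqVneq (W 0%N) 0.
  rewrite W00 add0r; apply: (IH (fun p => W p.+1)) => // p.
    by move=> hp; apply: h1.
  by move=> q hpq; apply: h2.
have {}Wpos : 0 < W 0%N by rewrite lt0r Wpos.
have : \sum_(p < t) W p.+1 <= 2 * (W 0%N / 2).
  apply: (IH (fun p => W p.+1)).
  - move=> p hp; have /andP[-> _] := h1 p.+1 hp.
    by have := h2 0%N p.+1 hp Wpos => h /=; lra.
  - by move=> p q hpq; apply: h2.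
  - by rewrite divr_ge0.
by move=> h; apply: (@le_trans _ _ (W 0%N + 2 * (W 0%N / 2))); [rewrite lerD2l|lra].
Qed.

Lemma geometric_level (R : realType) (tau0 x : R) (J : nat) :
  0 < tau0 -> tau0 < x -> x <= 2 ^+ J * tau0 ->
  exists2 j : 'I_J, 2 ^+ j * tau0 < x & x <= 2 * (2 ^+ j * tau0).
Proof.
move=> t0 hx; elim: J => [|J IH] hJ.
  by move: hJ; rewrite expr0 mul1r leNgt hx.
have [h|h] := lerP x (2 ^+ J * tau0).
  have [j h1 h2] := IH h; by exists (widen_ord (leqnSn J) j).
by exists ord_max => //=; rewrite mulrA -exprS.
Qed.

Section Expectation.
Variables (R : realType) (n : nat) (adj : rel 'I_n).
Hypothesis adj_simple : simple_graph adj.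
Hypothesis deg_gt0 : forall v, (0 < deg adj v)%N.

Local Notation label := (option (edge adj)).
Local Notation trans := (@trans R n adj).
Local Notation stat := (@stat R n adj).
Local Notation el := (@edge_label n adj).
Local Notation E := ((nedges adj)%:R : R).
Local Notation steps k := (nseq k (@one_label R n adj)).
Local Notation statE := (@statE R n adj).
Local Notation walkE := (@walkE R n adj).

Variables (B t : nat) (S : {set edge adj}) (h : edge adj -> R) (d tau0 nu kap : R).
Hypothesis mixing : forall k v (F : {set edge adj}), (B <= k)%N ->
  transfer (steps k) (hit_prob R F) v <= 2 * #|F|%:R / E.
Hypothesis E_gt0 : 0 < E.
Hypothesis small_S : 8 * t%:R * #|S|%:R <= E.
Hypothesis supp_h : forall e, h e != 0 -> e \in S.
Hypothesis d_gt0 : 0 < d.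
Hypothesis d_le : 2 * d <= 1.
Hypothesis tau0_gt0 : 0 < tau0.
Hypothesis nu_gt0 : 0 < nu.
Hypothesis kap_gt0 : 0 < kap.
Hypothesis kap_le : 2 * kap <= 1.
Hypothesis t_gt0 : (0 < t)%N.

Local Notation L := B.+1.

Definition hval (o : label) : R := oapp h 0 o.

Lemma hval_supp o : hval o != 0 -> label_in S o.
Proof. by case: o => [e|] /=; rewrite ?eqxx //; exact: supp_h. Qed.

Definition head_val (s : seq label) : R := hval (head None s).

Definition dominant (s : seq label) : bool :=
  (tau0 < `|head_val s|) && all (fun o => `|hval o| <= d * `|head_val s|) (behead s).

Definition dominant_val (s : seq label) : R := `|head_val s| * (dominant s)%:R.

(** Only values of sign opposite to the head of [s1] are restricted: those of the same sign cannot
    compensate it in a kernel row. *)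
Definition compatible (s1 s2 : seq label) : bool :=
  all (fun o => (hval o * head_val s1 < 0) ==> (`|hval o| <= d * `|head_val s1|)) s2.

Definition pair_val (s1 s2 : seq label) : R := dominant_val s1 * (compatible s1 s2)%:R.

Lemma dominant_val_ge0 s : 0 <= dominant_val s.
Proof. by rewrite mulr_ge0. Qed.

Lemma far_hits l i v : (L <= i.+1)%N ->
  walkE l v (fun s => (label_in S (nth None s i))%:R) <= 2 * #|S|%:R / E.
Proof.
move=> hi; case: (ltnP i l) => hl; first by rewrite walkE_hit // mixing.
rewrite (@eq_walkE R n adj _ _ _ (fun=> 0)) ?walkE_cst ?divr_ge0 ?mulr_ge0 //.
by move=> s hs; rewrite nth_default // hs.
Qed.

(* Maximising [|x_j| d^-j] over the first [L] steps finds a dominant position. *)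
Lemma exists_dominant lam s : lam * d ^+ L = 1 -> size s = (L + t)%N ->
  all (fun o => hval o == 0) (drop L s) -> lam * tau0 < `|head_val s| ->
  `|head_val s| <= lam * \sum_(j < L) dominant_val (take t (drop j s)).
Proof.
move=> hlam hs hfar hbig.
pose g i := `|hval (nth None s i)|.
have lam0 : 0 < lam.
  by rewrite -(pmulr_lgt0 _ (exprn_gt0 L d_gt0)) hlam.
have dlt1 : d <= 1 by move: d_le d_gt0; lra.
have [j hj] : exists j : 'I_L, forall i : 'I_L, g i / d ^+ i <= g j / d ^+ j.
  exists [arg max_(j > (@ord0 B)) (g j / d ^+ j)]%O.
  by case: arg_maxP => //= i _ hi i'; exact: hi.
have gge0 i : 0 <= g i by rewrite normr_ge0.
have g0 : g 0%N = `|head_val s| by rewrite /g nth0.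
have gj : `|head_val s| <= g j / d ^+ j.
  by have := hj ord0; rewrite /= expr0 divr1 g0.
have lamE : lam = (d ^+ L)^-1.
  by apply: (mulIf (lt0r_neq0 (exprn_gt0 L d_gt0))); rewrite hlam mulVf ?lt0r_neq0 ?exprn_gt0.
have dj : (d ^+ j)^-1 <= lam.
  by rewrite lamE lef_pV2 ?posrE ?exprn_gt0 // ler_wiXn2l ?(ltW d_gt0) // ltnW // ltn_ord.
have hlamj : `|head_val s| <= lam * g j.
  by apply: (le_trans gj); rewrite mulrC ler_wpM2r.
have tauj : tau0 < g j by rewrite -(ltr_pM2l lam0); exact: lt_le_trans hbig hlamj.
(* Within the first [L] positions this is maximality of [g j / d ^+ j]; beyond them all values
   vanish. *)
have later i : (j < i)%N -> g i <= d * g j.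
  move=> hi; case: (ltnP i L) => hiL.
    have := hj (Ordinal hiL); rewrite /= ler_pdivrMr ?exprn_gt0 //.
    rewrite mulrAC -mulrA -exprB ?unitfE ?lt0r_neq0 ?(ltnW hi) // mulrC => /le_trans; apply.
    apply: ler_wpM2r; first exact: gge0.
    by rewrite -[X in _ <= X](expr1 d); apply: ler_wiXn2l; rewrite ?(ltW d_gt0) ?subn_gt0.
  rewrite (_ : g i = 0) ?mulr_ge0 ?ltW //; first exact: lt_trans tauj.
  apply/eqP; rewrite normr_eq0; case: (ltnP i (size s)) => his; last by rewrite nth_default.
  have := allP hfar (nth None s i); apply.
  rewrite -(subnKC hiL) -nth_drop mem_nth // size_drop ltn_sub2r //.
  exact: leq_ltn_trans his.
apply: (le_trans hlamj); rewrite ler_pM2l // (bigD1 j) //=.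
suff -> : dominant_val (take t (drop j s)) = g j.
  by rewrite lerDl sumr_ge0 // => i _; exact: dominant_val_ge0.
have hd : head_val (take t (drop j s)) = hval (nth None s j).
  by rewrite /head_val -nth0 nth_take // nth_drop addn0.
rewrite /dominant_val /dominant hd -/(g j) tauj /=.
rewrite (_ : all _ _) ?mulr1 //; apply/allP => o ho.
have : o \in drop j.+1 s.
  rewrite -[j.+1]add1n -drop_drop drop1; move: ho; case: (drop j s) => [|a l] //.
  by case: (t) => //= t'; exact: mem_take.
by case/(nthP None) => i hi <-; rewrite nth_drop; apply: later; rewrite addSn ltnS leq_addr.
Qed.

(** Integrate [exists_dominant] over a stationary walk of length [L + t]. By stationarity each of
    the [L] windows has the law of a [t]-step walk. A return to [S] after the first [L] steps has
    probability at most 1/4, whatever the first step was, so at least half of the mass of the first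
    step survives. *)
Lemma dominant_stat lam : lam * d ^+ L = 1 ->
  (\sum_e `|h e| * (lam * tau0 < `|h e|)%R%:R) / (2 * E) <= lam * L%:R * statE t dominant_val.
Proof.
move=> hlam.
have lam0 : 0 < lam by rewrite -(pmulr_lgt0 _ (exprn_gt0 L d_gt0)) hlam.
pose phi (o : label) : R := `|hval o| * (lam * tau0 < `|hval o|)%R%:R.
have -> : lam * L%:R * statE t dominant_val =
  statE (L + t) (fun s => lam * \sum_(j < L) dominant_val (take t (drop j s))).
  rewrite statEZ statE_sum -mulrA; congr (_ * _).
  rewrite (eq_bigr (fun=> statE t dominant_val)); last first.
    move=> j _; have -> : (L + t = j + (t + (L - j)))%N by have := ltn_ord j; clear; lia.
    rewrite (statE_drop adj_simple deg_gt0 _ _ (fun s => dominant_val (take t s))).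
    by apply: eq_bigr => v _; rewrite walkE_take.
  by rewrite sumr_const card_ord mulr_natl.
(* The union bound in linear form: one late visit to [S] already makes the second factor
   nonpositive. *)
apply: (@le_trans _ _ (statE (L + t) (fun s => phi (head None s) *
    (1 - \sum_(i < t) (label_in S (nth None s (L + i)))%:R)))); last first.
  apply: ler_statE => s hs.
  have phi0 : 0 <= phi (head None s) by rewrite mulr_ge0.
  have D0 : 0 <= lam * \sum_(j < L) dominant_val (take t (drop j s)).
    by rewrite mulr_ge0 ?(ltW lam0) // sumr_ge0 // => j _; exact: dominant_val_ge0.
  case: (boolP (all (fun o => hval o == 0) (drop L s))) => hfar.
    rewrite (@le_trans _ _ (phi (head None s))) //.
      by rewrite ler_piMr // lerBlDr lerDl sumr_ge0.
    rewrite /phi; case: ltP => hb; last by rewrite mulr0.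
    by rewrite mulr1; apply: exists_dominant.
  apply: le_trans D0; rewrite mulr_ge0_le0 // subr_le0.
  case/allPn: hfar => o /(nthP None)[i hi <-] hne.
  have hit : (i < t)%N by move: hi; rewrite size_drop hs addKn.
  rewrite (bigD1 (Ordinal hit)) //= -nth_drop hval_supp // lerDl sumr_ge0 //.
have -> : (\sum_e `|h e| * (lam * tau0 < `|h e|)%R%:R) / (2 * E) =
  \sum_v stat v * (\sum_u trans v u * (phi (el v u) / 2)).
  rewrite (statE_step adj_simple deg_gt0 (fun o => phi o / 2)) -mulr_suml invfM mulrA.
  by rewrite -mulrA.
apply: ler_sum => v _; rewrite ler_wpM2l ?stat_ge0 //=.
apply: ler_sum => u _; rewrite ler_wpM2l ?trans_ge0 // walkEZ.
have phi0 : 0 <= phi (el v u) by rewrite mulr_ge0.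
rewrite ler_wpM2l //.
rewrite (@eq_walkE R n adj _ _ _ (fun s => 1 + (-1) * \sum_(i < t) (label_in S (nth None s (B + i)))%:R)); last first.
  by move=> s _; rewrite mulN1r.
rewrite walkED walkE_cst // walkEZ walkE_sum mulN1r.
have : \sum_(i < t) walkE (B + t) u (fun s => (label_in S (nth None s (B + i)))%:R) <=
  \sum_(i < t) (2 * #|S|%:R / E).
  by apply: ler_sum => i _; apply: far_hits; rewrite ltnS leq_addr.
rewrite sumr_const card_ord -[leRHS]mulr_natr.
have : 2 * #|S|%:R / E * t%:R <= 4^-1.
  rewrite mulrAC ler_pdivrMr //; move: small_S; lra.
by rewrite /=; lra.
Qed.

(** * Two independent walks from a fixed vertex *)

Section AtVertex.
Variable (w : 'I_n).
Local Notation EX := (walkE t w).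

Let near_mass s := \sum_(o <- take L s) `|hval o|.
(* The summand [nu] only keeps the denominator in Markov's inequality positive. *)
Definition typical_mass : R := 2 * EX near_mass + nu.
Local Notation m := typical_mass.

Lemma typical_mass_gt0 : 0 < m.
Proof.
rewrite ltr_wpDl // mulr_ge0 // walkE_ge0 // => s _.
by apply: sumr_ge0.
Qed.

(** By Markov's inequality the near mass exceeds [m] with probability at most 1/2, and a late visit
    to [S] has probability at most 1/4. Outside both events every value is at most [m]. *)
Lemma prob_small : 4^-1 <= EX (fun s => (all (fun o => `|hval o| <= m) s)%:R).
Proof.
have m0 := typical_mass_gt0.
apply: (@le_trans _ _ (EX (fun s => 1 + (- m^-1) * near_mass s +
    (-1) * \sum_(i < t) (label_in S (nth None s (L + i)))%:R))); last first.
  apply: ler_walkE => s hs.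
  have n0 : 0 <= near_mass s by apply: sumr_ge0.
  have s0 : 0 <= \sum_(i < t) (label_in S (nth None s (L + i)))%:R :> R by apply: sumr_ge0.
  have nm0 : 0 <= m^-1 * near_mass s by rewrite mulr_ge0 // invr_ge0 ltW.
  case: (boolP (all _ s)) => [_|/allPn[o ho hm]] /=; first by lra.
  rewrite -ltNge in hm; move: ho; rewrite -{1}(cat_take_drop L s) mem_cat => /orP[] ho.
    have : m <= near_mass s.
      apply: (@le_trans _ _ `|hval o|); first exact: ltW.
      rewrite /near_mass (big_rem o) //= lerDl; exact: sumr_ge0.
    by rewrite -(ler_pM2l (x := m^-1)) ?invr_gt0 // mulVf ?lt0r_neq0 //; lra.
  have hS : label_in S o by apply: hval_supp; rewrite -normr_gt0; apply: lt_trans hm.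
  case/(nthP None): ho => i hi hio.
  have hit : (i < t)%N by move: hi; rewrite size_drop hs => /leq_trans; apply; exact: leq_subr.
  have : 1 <= \sum_(i < t) (label_in S (nth None s (L + i)))%:R :> R.
    by rewrite (bigD1 (Ordinal hit)) //= -nth_drop hio hS lerDl sumr_ge0.
  by lra.
rewrite !walkED walkE_cst // !walkEZ walkE_sum.
have : \sum_(i < t) walkE t w (fun s => (label_in S (nth None s (L + i)))%:R) <=
  \sum_(i < t) (2 * #|S|%:R / E).
  by apply: ler_sum => i _; apply: far_hits; rewrite leqW // leq_addr.
rewrite sumr_const card_ord -[leRHS]mulr_natr.
have : 2 * #|S|%:R / E * t%:R <= 4^-1.
  rewrite mulrAC ler_pdivrMr //; move: small_S; lra.
have : m^-1 * EX near_mass <= 2^-1.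
  rewrite mulrC ler_pdivrMr // /typical_mass; move: nu_gt0; lra.
by rewrite /=; lra.
Qed.

Definition tame (b : bool) (s : seq label) : bool :=
  [&& dominant s, d * `|head_val s| < m & (0 < head_val s) == b].

Lemma dominant_neq0 s : dominant s -> head_val s != 0.
Proof. by case/andP => h1 _; rewrite -normr_gt0; exact: lt_trans h1. Qed.

Lemma dominant_val_split s : dominant_val s =
  dominant_val s * (m <= d * `|head_val s|)%R%:R +
  \sum_(b : bool) `|head_val s| * (tame b s)%:R.
Proof.
rewrite big_bool /tame /dominant_val; case: dominant => /=; last by rewrite !(mulr0, mul0r, addr0).
by rewrite leNgt; case: (d * _ < m) => /=; case: (0 < head_val s); rewrite /= !(mulr0, mulr1, addr0, add0r).
Qed.

(** There are two sources of compatibility. A head with [m <= d |head|] tolerates any half whose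
    values are at most [m]; and if both halves are tame of the same sign, the half with the larger
    head tolerates the other one, whose later values are at most [d] times its own smaller head. *)
Lemma pair_val_ge s1 s2 :
  dominant_val s1 * (m <= d * `|head_val s1|)%R%:R * (all (fun o => `|hval o| <= m) s2)%:R +
  \sum_(b : bool) `|head_val s1| * (tame b s1)%:R *
     ((tame b s2)%:R * (`|head_val s2| <= `|head_val s1|)%R%:R) <= pair_val s1 s2.
Proof.
rewrite big_bool /pair_val /dominant_val.
have c0 : 0 <= (compatible s1 s2)%:R :> R by [].
have x0 := normr_ge0 (head_val s1).
case: (boolP (dominant s1)) => hd; last first.
  by rewrite /tame (negbTE hd) /= !(mulr0, mul0r, addr0).
have tameP b : tame b s1 -> tame b s2 -> `|head_val s2| <= `|head_val s1| -> compatible s1 s2.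
  case/and3P => _ _ /eqP h1 /and3P[d2 _ /eqP h2] h12.
  have n1 := dominant_neq0 hd; have n2 := dominant_neq0 d2.
  case: s2 {c0} d2 h2 h12 n2 => // o s2 d2 h2 h12 n2.
  rewrite /compatible /=; apply/andP; split.
    apply/implyP => hneg; exfalso; move: hneg; rewrite -[hval o]/(head_val (o :: s2)).
    case: (ltrgtP 0 (head_val s1)) h1 n1 => [p1|p1|<-]; rewrite ?eqxx //= => h1 _;
    rewrite -{}h1 in h2; case: (ltrgtP 0 (head_val (o :: s2))) h2 n2 => // p2 _ _; rewrite ltNge.
    - by rewrite mulr_ge0 // ltW.
    - by rewrite mulr_le0 // ltW.
  apply/allP => o' ho'; apply/implyP => _.
  case/andP: d2 => _ /allP /(_ _ ho') /le_trans; apply.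
  by rewrite ler_pM2l.
have [hb|hb] := lerP m (d * `|head_val s1|).
  rewrite /tame ltNge hb /= !andbF !(mulr0, mul0r, addr0) !mulr1.
  case: (boolP (all _ s2)) => [hs|_]; last by rewrite mulr0 mulr_ge0.
  suff -> : compatible s1 s2 by rewrite mulr1.
  by apply/allP => o ho; apply/implyP => _; apply: le_trans hb; exact: (allP hs).
rewrite !(mulr0, mul0r, add0r) mulr1.
have excl : ~~ (tame true s1 && tame false s1).
  by rewrite /tame; case: (0 < head_val s1); rewrite /= !(andbF, andbT).
have key b : `|head_val s1| * (tame b s1)%:R *
     ((tame b s2)%:R * (`|head_val s2| <= `|head_val s1|)%R%:R) <=
     `|head_val s1| * (compatible s1 s2)%:R.
  case h1: (tame b s1); last by rewrite mulr0 mul0r mulr_ge0.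
  case h2: (tame b s2); last by rewrite mul0r mulr0 mulr_ge0.
  case: (boolP (`|head_val s2| <= _)) => h3; last by rewrite !mulr0 mulr_ge0.
  by rewrite (tameP b) // !mulr1.
case h1: (tame true s1) excl => /= excl.
  rewrite (negbTE excl) mulr0 mul0r addr0; have := key true; by rewrite h1.
by rewrite mulr0 mul0r add0r; exact: key.
Qed.

(* A dominant step either beats the typical mass, and then the other half is quiet
   with probability 1/4, or is tame; two tame halves of the same sign are compatible
   in one of the two orders, and tame steps of probability below [kap] are negligible. *)
Lemma pair_val_lower : kap / 2 * (EX dominant_val - 2 * kap * m / d) <=
  EX (fun s1 => EX (fun s2 => pair_val s1 s2)).
Proof.
have m0 := typical_mass_gt0.
pose big s := dominant_val s * (m <= d * `|head_val s|)%R%:R.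
pose small s : R := (all (fun o => `|hval o| <= m) s)%:R.
pose g b s : R := `|head_val s| * (tame b s)%:R.
pose I b s : R := (tame b s)%:R.
pose cmp s1 s2 : R := (`|head_val s2| <= `|head_val s1|)%R%:R.
have big0 s : 0 <= big s by rewrite !mulr_ge0.
have g0 b s : 0 <= g b s by rewrite mulr_ge0.
have I0 b s : 0 <= I b s by [].
apply: (@le_trans _ _ (EX (fun s1 => EX (fun s2 => big s1 * small s2 +
   \sum_b g b s1 * (I b s2 * cmp s1 s2))))); last first.
  by apply: ler_walkE => s1 _; apply: ler_walkE => s2 _; exact: pair_val_ge.
have -> : EX (fun s1 => EX (fun s2 => big s1 * small s2 + \sum_b g b s1 * (I b s2 * cmp s1 s2))) =
  EX big * EX small + \sum_b EX (fun s1 => EX (fun s2 => g b s1 * (I b s2 * cmp s1 s2))).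
  rewrite [X in _ = X + _]mulrC -walkEZ -walkE_sum -walkED; apply: eq_walkE => s1 _.
  by rewrite walkED walkEZ walkE_sum mulrC.
have -> : EX dominant_val = EX big + \sum_b EX (g b).
  by rewrite -walkE_sum -walkED; apply: eq_walkE => s _; exact: dominant_val_split.
have hbig : kap / 2 * EX big <= EX big * EX small.
  rewrite mulrC ler_wpM2l ?walkE_ge0 //.
  by apply: le_trans prob_small; move: kap_le; lra.
pose V b := EX (fun s1 => EX (fun s2 => g b s1 * (I b s2 * cmp s1 s2))).
have htame b : kap / 2 * (EX (g b) - kap * m / d) <= V b.
  (* The halves are independent with the same law, and one of the two comparisons between their
     heads always holds. *)
  have sym : EX (g b) * EX (I b) <= 2 * V b.
    rewrite /V mulr2n mulrDl mul1r {2}walkE_exchange -walkED mulrC -walkEZ.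
    apply: ler_walkE => s1 _; rewrite mulrC -walkEZ -walkED; apply: ler_walkE => s2 _.
    rewrite /g /I /cmp; case: (tame b s1); case: (tame b s2); rewrite ?(mulr0, mul0r, addr0) //=.
    rewrite !(mulr1, mul1r); case: (lerP `|head_val s2| `|head_val s1|) => hle.
      by rewrite mulr1 lerDl mulr_ge0.
    by rewrite mulr0 add0r (ltW hle) mulr1 ltW.
  have gI : EX (g b) <= m / d * EX (I b).
    rewrite -walkEZ; apply: ler_walkE => s _; rewrite /g /I.
    case hbs: (tame b s); last by rewrite !mulr0.
    by rewrite !mulr1 ler_pdivlMr // mulrC ltW //; case/and3P: hbs.
  have V0 : 0 <= V b.
    by apply: walkE_ge0 => // s1 _; apply: walkE_ge0 => // s2 _; rewrite !mulr_ge0.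
  have a0 : 0 <= EX (g b) by apply: walkE_ge0.
  have md0 : 0 < m / d by rewrite divr_gt0.
  rewrite -(mulrA kap m); move: sym gI V0 a0 md0 kap_gt0.
  move: (EX (g b)) (EX (I b)) (V b) (m / d) => a p {}V q sym gI V0 a0 q0 k0.
  have kq : 0 <= kap * (kap * q) by rewrite !mulr_ge0 // ltW.
  (* If tame halves of this sign have probability at least [kap], symmetrization gives the bound;
     otherwise [gI] makes the left-hand side nonpositive. *)
  have [hp|hp] := lerP kap p.
    have : a * kap <= 2 * V by apply: le_trans sym; apply: ler_wpM2l.
    by lra.
  apply: le_trans V0; apply: mulr_ge0_le0; first by rewrite divr_ge0 // ltW.
  rewrite subr_le0; apply: (le_trans gI); rewrite mulrC.
  by apply: ler_wpM2r; apply: ltW.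
have := htame true; have := htame false; rewrite !big_bool /= -/(V true) -/(V false); move: hbig.
move: (EX (g true)) (EX (g false)) (EX big * EX small) (EX big) (V true) (V false) => g1 g2 bs b1 V1 V2.
rewrite (_ : 2 * kap * m / d = 2 * (kap * m / d)); last by rewrite -!mulrA.
by move: (kap * m / d) => q; lra.
Qed.

End AtVertex.




Lemma statE_nth_le i : statE t (fun s => `|hval (nth None s i)|) <= (\sum_e `|h e|) / E.
Proof.
have [hi|hi] := ltnP i t; last first.
  rewrite (@eq_statE _ _ _ _ _ (fun=> 0)); last first.
    by move=> s hs; rewrite nth_default ?hs //= normr0.
  apply: (le_trans (statE_cst_le _ _ _ _)) => //.
  by rewrite divr_ge0 // sumr_ge0.
rewrite -(subnKC (ltnW hi)).
rewrite (@eq_statE _ _ _ _ _ (fun s => (fun s' => `|hval (nth None s' 0)|) (drop i s))); last first.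
  by move=> s _; rewrite nth_drop addn0.
rewrite (statE_drop adj_simple deg_gt0 i (t - i) (fun s => `|hval (nth None s 0)|)).
rewrite -(statE_step adj_simple deg_gt0 (fun o => `|hval o|)).
rewrite le_eqVlt; apply/orP; left; apply/eqP; apply: eq_bigr => v _; congr (_ * _).
rewrite -(prednK (n := t - i)) ?subn_gt0 //=.
by apply: eq_bigr => u _; rewrite walkE_cst.
Qed.

(** By stationarity each of the [L] near values has mean at most the average of [h] in absolute
    value over the edges. *)
Lemma stat_typical_mass : \sum_w stat w * typical_mass w <= 2 * L%:R * (\sum_e `|h e|) / E + nu.
Proof.
have mass0 : 0 <= \sum_e `|h e| by apply: sumr_ge0.
under eq_bigr => w _ do rewrite mulrDr mulrCA.
rewrite big_split /= -mulr_sumr -mulr_suml; apply: lerD; last first.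
  by rewrite ler_piMl ?(ltW nu_gt0) // sum_stat_le1.
rewrite -!mulrA ler_pM2l // -/(statE t _).
apply: (@le_trans _ _ (statE t (fun s => \sum_(i < L) `|hval (nth None s i)|))).
  apply: ler_statE => s hs.
  rewrite (big_nth None) big_mkord.
  have hsz : (size (take L s) <= L)%N by rewrite size_take; case: ifP => // /negbT; rewrite -leqNgt.
  rewrite (eq_bigr (fun i : 'I_(size (take L s)) => `|hval (nth None s i)|)); last first.
    by move=> i _; rewrite nth_take //; apply: leq_trans hsz.
  rewrite -(big_mkord predT (fun i => `|hval (nth None s i)|)).
  rewrite -(big_mkord predT (fun i => `|hval (nth None s i)|)).
  by rewrite [leRHS](big_cat_nat _ hsz) //= lerDl sumr_ge0.
rewrite statE_sum mulr_natl -[X in _ *+ X](card_ord L) -sumr_const.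
by apply: ler_sum => i _; exact: statE_nth_le.
Qed.

Lemma pair_stat lam : lam * d ^+ L = 1 ->
  kap / 2 * ((\sum_e `|h e| * (lam * tau0 < `|h e|)%R%:R) / (2 * E) / (lam * L%:R) -
     2 * kap / d * (2 * L%:R * (\sum_e `|h e|) / E + nu)) <=
  \sum_w stat w * walkE t w (fun s1 => walkE t w (fun s2 => pair_val s1 s2)).
Proof.
move=> hlam.
have lam0 : 0 < lam by rewrite -(pmulr_lgt0 _ (exprn_gt0 L d_gt0)) hlam.
apply: (@le_trans _ _ (\sum_w stat w * (kap / 2 *
   (walkE t w dominant_val - 2 * kap * typical_mass w / d)))); last first.
  by apply: ler_sum => w _; rewrite ler_wpM2l ?stat_ge0 //; exact: pair_val_lower.
under [leRHS]eq_bigr => w _ do rewrite mulrCA mulrBr.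
rewrite -mulr_sumr; apply: ler_wpM2l; first by rewrite divr_ge0 // ltW.
rewrite sumrB lerB //.
  rewrite ler_pdivrMr ?mulr_gt0 // [leRHS]mulrC; exact: dominant_stat.
rewrite (eq_bigr (fun w => 2 * kap / d * (stat w * typical_mass w))); last first.
  by move=> w _; ring.
rewrite -mulr_sumr; apply: ler_wpM2l; last exact: stat_typical_mass.
by rewrite divr_ge0 ?mulr_ge0 // ltW.
Qed.

Definition split_val (p : nat) (s : seq label) : R :=
  pair_val (drop p s) (take p s).

(** Truncating two full walks to the lengths on both sides of the cut keeps domination and
    compatibility. Compatibility ignores the order of the other half, so that half may be reversed
    and glued back by [statE_split]. *)
Lemma split_stat p : (p < t)%N ->
  \sum_w stat w * walkE t w (fun s1 => walkE t w (fun s2 => pair_val s1 s2)) <=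
  statE t (split_val p).
Proof.
move=> hp; rewrite -[in leRHS](subnKC (ltnW hp)) statE_split //.
apply: ler_sum => w _; rewrite ler_wpM2l ?stat_ge0 // walkE_exchange.
rewrite -[in leLHS](subnKC (ltnW hp)) -[leRHS](walkE_take deg_gt0 p (t - p)).
apply: ler_walkE => s1 hs1.
rewrite [X in walkE X w _ <= _]addnC -[leRHS](walkE_take deg_gt0 (t - p) p).
apply: ler_walkE => s2 hs2.
have hsz : size (rev (take p s1)) = p.
  by rewrite size_rev size_takel // hs1 leq_addr.
rewrite /split_val drop_size_cat // take_size_cat //.
have hdd : (0 < t - p)%N by rewrite subn_gt0.
have hhead : head_val (take (t - p) s2) = head_val s2.
  by rewrite /head_val; case: (s2) (t - p)%N hdd => [|o s2'] [].
rewrite /pair_val /dominant_val hhead.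
have dom : dominant s2 -> dominant (take (t - p) s2).
  rewrite /dominant hhead => /andP[-> /= /allP hall]; apply/allP => o ho; apply: hall.
  move: ho; case: (s2) => [|o' s2'] //; case: (t - p)%N => //= k; exact: mem_take.
have cmp : compatible s2 s1 -> compatible (take (t - p) s2) (rev (take p s1)).
  rewrite /compatible hhead => /allP hall; apply/allP => o; rewrite mem_rev => ho.
  by apply: hall; exact: mem_take ho.
case: (boolP (dominant s2)) => [/dom ->|_]; last by rewrite mulr0 mul0r !mulr_ge0.
case: (boolP (compatible s2 s1)) => [/cmp ->|_]; first by rewrite !mulr1.
by rewrite mulr0 !mulr_ge0.
Qed.

Definition hit_avoid (U N : {set edge adj}) (s : seq label) : bool :=
  has (label_in U) s && ~~ has (label_in N) s.

Definition level (j : nat) : R := 2 ^+ j * tau0.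
Definition exceed (b : bool) (tau : R) : {set edge adj} :=
  [set e | tau < (if b then h e else - h e)].

Lemma label_in_exceed b tau o : 0 <= tau ->
  label_in (exceed b tau) o = (tau < (if b then hval o else - hval o)).
Proof.
move=> h0; case: o => [e|] /=; first by rewrite inE.
by rewrite oppr0 if_same ltNge h0.
Qed.

(** The nonzero split values at least halve from one cut to the next, by domination, so their sum is
    at most twice the largest bound. Each is at most twice its dyadic level, at which the walk is
    selected with the matching sign. *)
Lemma split_levels J s : size s = t -> (forall e, `|h e| <= level J) ->
  \sum_(p < t) split_val p s <=
  4 * \sum_(j < J) \sum_(b : bool)
     level j * (hit_avoid (exceed b (level j)) (exceed (~~ b) (2 * d * level j)) s)%:R.
Proof.
move=> hs hJ.
set Z := \sum_(j < J) _.
have lev0 j : 0 < level j by rewrite mulr_gt0 // exprn_gt0.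
have Z0 : 0 <= Z by apply: sumr_ge0 => j _; apply: sumr_ge0 => b _; rewrite mulr_ge0 // ltW.
have good p : (p < t)%N -> split_val p s != 0 ->
   [/\ split_val p s = `|hval (nth None s p)|, tau0 < `|hval (nth None s p)|,
     (forall i, (p < i)%N -> `|hval (nth None s i)| <= d * `|hval (nth None s p)|) &
     (forall i, (i < p)%N -> hval (nth None s i) * hval (nth None s p) < 0 ->
        `|hval (nth None s i)| <= d * `|hval (nth None s p)|)].
  move=> hp; rewrite /split_val /pair_val /dominant_val.
  have -> : head_val (drop p s) = hval (nth None s p).
    by rewrite /head_val -nth0 nth_drop addn0.
  case hd: (dominant (drop p s)); last by rewrite mulr0 mul0r eqxx.
  case hc: (compatible _ _); last by rewrite mulr0 eqxx.
  rewrite !mulr1 => hne.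
  have hh : head_val (drop p s) = hval (nth None s p).
    by rewrite /head_val -nth0 nth_drop addn0.
  case/andP: hd; rewrite hh => h1 /allP h2; split=> // i hi.
    case: (ltnP i (size s)) => his; last by rewrite nth_default //= normr0 mulr_ge0 // ltW.
    apply: h2; rewrite -drop1 drop_drop add1n -(subnKC hi) -nth_drop mem_nth //.
    by rewrite size_drop ltn_sub2r // (leq_ltn_trans hi).
  move=> hneg; move/allP: hc => /(_ (nth None s i)); rewrite hh hneg /=; apply.
  rewrite -(nth_take _ hi) mem_nth // size_takel // ltnW // hs //.
have bound p : (p < t)%N -> 0 <= split_val p s <= 2 * Z.
  move=> hp; have -> /= : 0 <= split_val p s by rewrite !mulr_ge0.
  have [->|hne] := eqVneq (split_val p s) 0; first by rewrite mulr_ge0.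
  have [-> h1 h2 h3] := good p hp hne.
  have [e he] : exists e, nth None s p = Some e.
    case: (nth None s p) h1 => [e|] /=; first by exists e.
    by rewrite normr0 ltNge ltW.
  have hxJ : `|hval (nth None s p)| <= 2 ^+ J * tau0 by rewrite he; exact: hJ.
  have [j hj1 hj2] := geometric_level tau0_gt0 h1 hxJ.
  apply: (le_trans hj2); rewrite ler_pM2l //.
  have lv2 : 0 <= 2 * d * level j.
    by apply: mulr_ge0; [rewrite mulr_ge0 // ltW|exact: ltW].
  pose b := 0 < hval (nth None s p).
  rewrite /Z (bigD1 j) //= (bigD1 b) //=.
  rewrite (_ : hit_avoid _ _ _) ?mulr1; last first.
    have habs : (if b then hval (nth None s p) else - hval (nth None s p)) = `|hval (nth None s p)|.
      by rewrite /b; case: ltP => hb; [rewrite gtr0_norm|rewrite ler0_norm].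
    apply/andP; split.
      apply/hasP; exists (nth None s p); first by rewrite mem_nth // hs.
      by rewrite label_in_exceed ?(ltW (lev0 j)) // habs.
    apply/hasPn => o /(nthP None)[i hi <-].
    rewrite label_in_exceed; last exact: lv2.
    rewrite -leNgt.
    (* The large value is at most twice its level, whence the threshold [2 * d] in place of [d]. *)
    have small : `|hval (nth None s i)| <= d * `|hval (nth None s p)| ->
        (if ~~ b then hval (nth None s i) else - hval (nth None s i)) <= 2 * d * level j.
      move=> hsm; apply: (@le_trans _ _ `|hval (nth None s i)|).
        by case: (~~ b); [exact: ler_norm|rewrite -normrN ler_norm].
      by apply: (le_trans hsm); rewrite [2 * d]mulrC -mulrA ler_pM2l.
    case: (ltngtP p i) => hpi; first by apply: small; exact: h2.
      have [hneg|hpos] := ltP (hval (nth None s i) * hval (nth None s p)) 0.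
        by apply: small; exact: h3.
      apply: (@le_trans _ _ 0); last exact: lv2.
      move: hpos; rewrite /b; case: ltP => hb /=; first by rewrite pmulr_lge0 // oppr_le0.
      rewrite nmulr_lge0 // lt_neqAle hb andbT -normr_gt0; exact: lt_trans h1.
    subst i; apply: (@le_trans _ _ 0); last exact: lv2.
    by rewrite /b; case: ltP => hb //=; rewrite oppr_le0 ltW.
  rewrite -addrA lerDl addr_ge0 //.
    by apply: sumr_ge0 => b' _; rewrite mulr_ge0 // ltW.
  by apply: sumr_ge0 => j' _; apply: sumr_ge0 => b' _; rewrite mulr_ge0 // ltW.
rewrite (_ : 4 * Z = 2 * (2 * Z)); last by ring.
apply: (@sum_halving _ t (fun p => split_val p s)) => //; last by rewrite mulr_ge0.
move=> p q /andP[hpq hq] hW.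
have hp : (p < t)%N by exact: ltn_trans hpq hq.
have [h0 _ h2 _] := good p hp (lt0r_neq0 hW).
have [->|hq0] := eqVneq (split_val q s) 0; first by rewrite mulr0 ltW.
have [-> _ _ _] := good q hq hq0; rewrite h0.
have := h2 q hpq; have := normr_ge0 (hval (nth None s p)); move: d_le d_gt0.
move: `|_| `|_| => x y; nra.
Qed.

Lemma level_stat lam J : lam * d ^+ L = 1 -> (forall e, `|h e| <= level J) ->
  t%:R * (kap / 2 * ((\sum_e `|h e| * (lam * tau0 < `|h e|)%R%:R) / (2 * E) / (lam * L%:R) -
     2 * kap / d * (2 * L%:R * (\sum_e `|h e|) / E + nu))) <=
  4 * \sum_(j < J) \sum_(b : bool) level j *
     statE t (fun s => (hit_avoid (exceed b (level j)) (exceed (~~ b) (2 * d * level j)) s)%:R).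
Proof.
move=> hlam hJ.
apply: (@le_trans _ _ (\sum_(p < t) statE t (split_val p))).
  rewrite mulr_natl -[X in _ *+ X](card_ord t) -sumr_const; apply: ler_sum => p _.
  exact: le_trans (pair_stat hlam) (split_stat (ltn_ord p)).
rewrite -statE_sum.
apply: (le_trans (ler_statE (fun s hs => split_levels hs hJ))).
rewrite statEZ statE_sum le_eqVlt; apply/orP; left; apply/eqP; congr (_ * _).
apply: eq_bigr => j _; rewrite statE_sum; apply: eq_bigr => b _.
by rewrite statEZ.
Qed.

End Expectation.

(** * Compensation in a row of the kernel *)

(** The largest selected power of 2 dominates all the smaller ones together. *)
Lemma geometric_sum_le (R : realType) (tau C : R) (J : nat) (P : pred nat) : 0 <= tau -> 0 <= C ->
  (forall j, (j < J)%N -> P j -> 2 ^+ j * tau <= C) ->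
  \sum_(j < J) 2 ^+ j * tau * (P j)%:R <= 2 * C.
Proof.
move=> tau0 C0.
have full k : \sum_(j < k) 2 ^+ j * tau * (P j)%:R <= 2 ^+ k * tau.
  elim: k => [|k IH]; first by rewrite big_ord0 mulr_ge0.
  have h1 : 2 ^+ k * tau * (P k)%:R <= 2 ^+ k * tau.
    by rewrite ler_piMr ?mulr_ge0 ?exprn_ge0 //; case: (P k).
  by rewrite big_ord_recr /= exprS -mulrA; lra.
elim: J => [|J IH] h; first by rewrite big_ord0 mulr_ge0.
case hP: (P J); last first.
  rewrite big_ord_recr /= hP mulr0 addr0; apply: IH => j hj.
  by apply: h; exact: leqW.
apply: (le_trans (full J.+1)); rewrite exprS -mulrA ler_pM2l //.
exact: h.
Qed.

(* Abel summation over the level sets of [g]. *)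
Lemma layer_cake_le0 (R : realType) (I : finType) (g z : I -> R) :
  (forall i, 0 <= g i) -> (forall u, 0 <= u -> \sum_(i | u < g i) z i <= 0) ->
  \sum_i g i * z i <= 0.
Proof.
have [k hk] := ubnP #|[pred i | 0 < g i]|; elim: k g hk => // k IH g hk g0 hz.
have [i0 hi0|none] := pickP [pred i | 0 < g i]; last first.
  rewrite big1 // => i _; have := none i; rewrite inE /= lt0r g0 andbT => /negbFE/eqP ->.
  by rewrite mul0r.
have [i1 hi1 hmin] : exists2 i, 0 < g i & (forall j, 0 < g j -> g i <= g j).
  by exists [arg min_(i < i0 | 0 < g i) g i]%O; case: arg_minP.
pose mu := g i1.
(* Subtracting the least positive value shrinks the support strictly, and the superlevel sets of
   [g'] are superlevel sets of [g] at shifted heights. *)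
pose g' i := if 0 < g i then g i - mu else 0.
have lev u i : 0 <= u -> (u < g' i) = (u + mu < g i).
  move=> u0; rewrite /g'; case: ifP => [_|/negbT]; first by rewrite ltrBrDr.
  rewrite -leNgt => gi; rewrite !ltNge u0; apply/esym/negbF.
  by apply: (le_trans gi); rewrite addr_ge0 // ltW.
have -> : \sum_i g i * z i = \sum_i g' i * z i + mu * \sum_(i | 0 < g i) z i.
  rewrite mulr_sumr [X in _ + X]big_mkcond -big_split; apply: eq_bigr => i _ /=.
  rewrite /g'; case: ifP => [_|/negbT]; first by ring.
  by rewrite -leNgt => gi; rewrite (le_anti (introT andP (conj gi (g0 i)))) !mul0r addr0.
rewrite -[leRHS]addr0; apply: lerD; last by rewrite mulr_ge0_le0 ?hz // ltW.
apply: IH.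
- apply: (@leq_trans #|[pred i | 0 < g i]|); last by rewrite -ltnS.
  apply: proper_card; apply/properP; split.
    apply/subsetP => i; rewrite !inE lev // => h; apply: lt_trans h.
    by rewrite add0r.
  by exists i1; rewrite !inE // lev // add0r ltxx.
- by move=> i; rewrite /g'; case: ifP => // hi; rewrite subr_ge0 hmin.
- move=> u u0; rewrite (eq_bigl (fun i => u + mu < g i)); last by move=> i; rewrite lev.
  by apply: hz; rewrite addr_ge0 // ltW.
Qed.

Section Rows.
Variables (R : realType) (n : nat) (adj : rel 'I_n).
Local Notation label := (option (edge adj)).
Variables (B : nat) (h : edge adj -> R) (S : {set edge adj}).

(** Asking for a strictly larger partner in [S] keeps the partners of a superlevel set of [S] inside
    that same set, so [few_far] can be applied to it. *)
Definition far_larger (s : seq label) (f : edge adj) : bool :=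
  [exists e in S, (`|h f| < `|h e|) && far B s e f].

Definition far_mass (s : seq label) : R := \sum_f `|h f| * (far_larger s f)%:R.

Lemma far_mass_ge0 s : 0 <= far_mass s.
Proof. by apply: sumr_ge0 => f _; rewrite mulr_ge0. Qed.

(** Fix one visit of [e]: an edge that is not far from [e] has all its visits within [B] of that
    time, a window of [2 B + 1] positions. *)
Lemma near_card (s : seq label) (e : edge adj) : Some e \in s ->
  (#|[set f | (Some f \in s) && ~~ far B s e f]| <= (2 * B).+1)%N.
Proof.
case/(nthP None) => p hp he.
have -> : #|[set f | (Some f \in s) && ~~ far B s e f]| =
   #|(@Some _) @: [set f | (Some f \in s) && ~~ far B s e f]|.
  by rewrite card_imset //; move=> ? ? [].
rewrite -[leqRHS](size_iota (p - B)) -(size_map (nth None s)).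
apply: leq_trans (card_size _); apply: subset_leq_card; apply/subsetP => o /imsetP[f].
rewrite in_set => /andP[/(nthP None)[q hq hf] hnf] ->; rewrite -hf; apply: map_f.
rewrite mem_iota; move: hnf; apply: contraNT => hout.
apply/existsP; exists (Ordinal hp); apply/existsP; exists (Ordinal hq).
by rewrite /= he hf !eqxx !andbT; lia.
Qed.

(** Up to sign, some traversed edge contributes more than [tau]. As entries are at most 2, the
    traversed negative values total at least [tau / 2]. The near ones account for at most
    [(2 B + 1) delta tau = tau / 4]; the others are far and smaller than the large edge. *)
Lemma compensation (A : edge adj -> nat) (s : seq label) (b : bool) (tau delta : R) :
  0 < tau -> 0 < delta -> 4 * (2 * B).+1%:R * delta = 1 ->
  (forall e, (0 < A e)%N = (Some e \in s)) -> (forall e, (A e <= 2)%N) ->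
  \sum_e (A e)%:R * h e = 0 ->
  (forall e, tau < `|h e| -> e \in S) -> delta <= 1 ->
  hit_avoid (exceed h b tau) (exceed h (~~ b) (delta * tau)) s ->
  tau <= 4 * far_mass s.
Proof.
move=> tau0 delta0 hdelta hA A2 hker hS delta1 /andP[/hasP[o ho]].
pose g e := if b then h e else - h e.
have gabs e : `|g e| = `|h e| by rewrite /g; case: (b); rewrite ?normrN.
have hkerg : \sum_e (A e)%:R * g e = 0.
  rewrite /g; case: (b) => //.
  by under eq_bigr => e _ do rewrite mulrN; rewrite sumrN hker oppr0.
case: o ho => [e0|] // he0 /=; rewrite inE -/(g e0) => hg0 /hasPn havoid.
have low f : Some f \in s -> - (delta * tau) <= g f.
  move=> /havoid /=; rewrite inE -leNgt /g; case: (b) => /=; rewrite ?opprK; lra.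
have e0S : e0 \in S by apply: hS; rewrite -gabs; apply: lt_le_trans hg0 (ler_norm _).
pose neg f : R := if (Some f \in s) && (g f < 0) then `|g f| else 0.
have neg0 f : 0 <= neg f by rewrite /neg; case: ifP.
have step1 : tau <= 2 * \sum_f neg f.
  have : \sum_e (A e)%:R * g e + 2 * \sum_f neg f >= tau.
    rewrite mulr_sumr -big_split /= (bigD1 e0) //= -[leLHS]addr0; apply: lerD.
      apply: (le_trans (ltW hg0)).
      have A1 : 1 <= (A e0)%:R :> R by rewrite ler1n hA.
      have gp : 0 <= g e0 by apply: ltW; apply: lt_trans hg0.
      by have := neg0 e0; nra.
    apply: sumr_ge0 => f _; rewrite /neg.
    case: (boolP (Some f \in s)) => hf /=; last first.
      by move: hf; rewrite -hA lt0n negbK => /eqP ->; rewrite mul0r mulr0 addr0.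
    case: ltP => hgf; last by rewrite mulr0 addr0 mulr_ge0.
    have : (A f)%:R <= 2 :> R by rewrite ler_nat.
    by rewrite ltr0_norm //; nra.
  by rewrite hkerg add0r.
have step2 f : neg f <= delta * tau * ((Some f \in s) && ~~ far B s e0 f)%:R +
    `|h f| * (far_larger s f)%:R.
  rewrite /neg; case: ifP => [/andP[hf hneg]|_]; last first.
    by rewrite addr_ge0 ?mulr_ge0 // ltW.
  have hsmall : `|g f| <= delta * tau by rewrite ltr0_norm //; have := low f hf; lra.
  rewrite hf /=; case: (boolP (far B s e0 f)) => hfar /=; last first.
    by rewrite mulr1 -[leLHS]addr0 lerD // mulr_ge0.
  rewrite (_ : far_larger s f); first by rewrite mulr0 mulr1 add0r gabs.
  apply/existsP; exists e0; rewrite e0S hfar andbT -!gabs /=.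
  apply: (le_lt_trans hsmall); apply: (@le_lt_trans _ _ tau).
    by rewrite ler_piMl // ltW.
  by apply: lt_le_trans hg0 (ler_norm _).
have step3 : \sum_f neg f <= delta * tau * (2 * B).+1%:R + far_mass s.
  apply: (le_trans (ler_sum _ (fun f _ => step2 f))); rewrite big_split /= lerD2r.
  rewrite -mulr_sumr ler_wpM2l ?mulr_ge0 ?(ltW tau0) ?(ltW delta0) //.
  rewrite -natr_sum ler_nat; apply: leq_trans (near_card he0).
  rewrite -sum1_card [leqRHS]big_mkcond; apply: leq_sum => f _ /=.
  by rewrite inE; case: (_ && _).
move: step1 step3; rewrite mulrAC.
have -> : delta * (2 * B).+1%:R * tau = tau / 4.
  have -> : delta * (2 * B).+1%:R = 4^-1.
    have h4 : 4 != 0 :> R by rewrite pnatr_eq0.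
    by apply: (mulfI h4); rewrite mulfV // mulrCA mulrC.
  by rewrite mulrC.
by move=> *; lra.
Qed.

Lemma compensation_levels (A : edge adj -> nat) (s : seq label) (b : bool) (tau delta : R) J :
  0 < tau -> 0 < delta -> 4 * (2 * B).+1%:R * delta = 1 ->
  (forall e, (0 < A e)%N = (Some e \in s)) -> (forall e, (A e <= 2)%N) ->
  \sum_e (A e)%:R * h e = 0 ->
  (forall e, tau < `|h e| -> e \in S) -> delta <= 1 ->
  \sum_(j < J) level tau j *
    (hit_avoid (exceed h b (level tau j)) (exceed h (~~ b) (delta * level tau j)) s)%:R
  <= 8 * far_mass s.
Proof.
move=> tau0 delta0 hdelta hA A2 hker hS delta1.
have -> : 8 * far_mass s = 2 * (4 * far_mass s) by ring.
apply: (@geometric_sum_le R tau (4 * far_mass s) J (fun j =>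
   hit_avoid (exceed h b (level tau j)) (exceed h (~~ b) (delta * level tau j)) s)).
- exact: ltW.
- by rewrite mulr_ge0 // far_mass_ge0.
- move=> j _; apply: compensation => //; first by rewrite mulr_gt0 // exprn_gt0.
  move=> e he; apply: hS; apply: le_lt_trans he.
  by rewrite ler_peMl ?(ltW tau0) // exprn_ege1 // ler1n.
Qed.

End Rows.

(** * The far mass summed over all rows *)

Section FarTotal.
Variables (R : realType) (n : nat) (adj : rel 'I_n).
Local Notation label := (option (edge adj)).
Variables (B m : nat) (ls : 'I_m -> seq label) (h : edge adj -> R) (K D : R).
Hypothesis K_gt0 : 0 < K.
Hypothesis D_gt0 : 0 < D.
Let D_ge0 : 0 <= D := ltW D_gt0.
Hypothesis few_far : forall X F : {set edge adj}, #|X|%:R <= K -> #|F|%:R <= K ->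
  \sum_i (far_count B X F (ls i))%:R <= D * (#|X|%:R + #|F|%:R).

Definition top_set : {set edge adj} := [set e | (\sum_e `|h e|) / K < `|h e|].
Local Notation S := top_set.
Local Notation N1 := (\sum_e `|h e|).

Lemma top_set_card : #|S|%:R <= K.
Proof.
have N0 : 0 <= N1 by apply: sumr_ge0.
have [N00|Npos] := eqVneq N1 0.
  suff -> : S = set0 by rewrite cards0 ltW.
  apply/setP => e; rewrite !inE N00 mul0r; apply/negbTE; rewrite -leNgt -N00.
  by rewrite (bigD1 e) //= lerDl sumr_ge0.
have {}Npos : 0 < N1 by rewrite lt0r Npos.
rewrite -(ler_pM2r (divr_gt0 Npos K_gt0)) [leRHS]mulrCA mulfV ?lt0r_neq0 // mulr1.
rewrite mulr_natl -sumr_const.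
apply: (@le_trans _ _ (\sum_(e in S) `|h e|)).
  by apply: ler_sum => e; rewrite inE => /ltW.
by rewrite [leRHS](bigID (mem S)) /= lerDl sumr_ge0.
Qed.

Let x f : R := \sum_i (far_larger B h S (ls i) f)%:R.

Lemma far_mass_sum : \sum_i far_mass B h S (ls i) = \sum_f `|h f| * x f.
Proof.
rewrite exchange_big; apply: eq_bigr => f _ /=.
by rewrite mulr_sumr.
Qed.

Lemma sum_far_larger (X F : {set edge adj}) :
  (forall f e, f \in F -> e \in S -> `|h f| < `|h e| -> e \in X) ->
  #|X|%:R <= K -> #|F|%:R <= K -> \sum_(f in F) x f <= D * (#|X|%:R + #|F|%:R).
Proof.
move=> hX cX cF; apply: le_trans (few_far cX cF).
rewrite exchange_big; apply: ler_sum => i _ /=.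
rewrite -natr_sum ler_nat /far_count -sum1_card.
rewrite [leqLHS]big_mkcond [leqRHS]big_mkcond; apply: leq_sum => f _ /=.
rewrite inE; case: (boolP (f \in F)) => hf //=.
case: (boolP (far_larger _ _ _ _ _)) => //= /existsP[e /and3P[eS hlt hfar]].
by rewrite (_ : [exists e in X, _]) //; apply/existsP; exists e; rewrite hfar (hX f e).
Qed.

(** The constant 8 is 2 for the edges of [S], 2 for the exceptional edges [H] outside [S], and 4 for
    all remaining edges. *)
Lemma far_mass_total : \sum_i far_mass B h S (ls i) <= 8 * D * N1.
Proof.
have N0 : 0 <= N1 by apply: sumr_ge0.
have x0 f : 0 <= x f by apply: sumr_ge0.
have cS := top_set_card.
rewrite far_mass_sum (bigID (mem S)) /=.
have part1 : \sum_(f in S) `|h f| * x f <= 2 * D * N1.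
  pose g f : R := if f \in S then `|h f| else 0.
  have g0 f : 0 <= g f by rewrite /g; case: ifP.
  (* On a superlevel set [Su] of [S] all larger partners lie in [Su] too, so [few_far] with
     [X = F = Su] bounds the average of [x] by [2 * D]. *)
  have : \sum_f g f * (x f - 2 * D) <= 0.
    apply: layer_cake_le0 => // u u0.
    pose Su := [set f in S | u < `|h f|].
    rewrite (eq_bigl (fun f => f \in Su)); last first.
      by move=> f; rewrite inE /g; case: (f \in S) => //=; rewrite ltNge u0.
    have cSu : #|Su|%:R <= K.
      apply: le_trans cS; rewrite ler_nat subset_leq_card //.
      by apply/subsetP => f; rewrite inE => /andP[].
    rewrite sumrB sumr_const -[_ *+ _]mulr_natl subr_le0.
    have -> : #|Su|%:R * (2 * D) = D * (#|Su|%:R + #|Su|%:R) by ring.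
    apply: sum_far_larger => // f e; rewrite !inE => /andP[_ hf] heS hlt.
    by rewrite heS; exact: lt_trans hlt.
  rewrite (eq_bigr (fun f => g f * x f - 2 * D * g f)); last by move=> f _; ring.
  rewrite sumrB subr_le0 -mulr_sumr => hle.
  rewrite big_mkcond (eq_bigr (fun f => g f * x f)); last first.
    by move=> f _; rewrite /g; case: ifP => //; rewrite mul0r.
  apply: (le_trans hle); rewrite ler_wpM2l ?mulr_ge0 //.
  by apply: ler_sum => f _; rewrite /g; case: ifP.
pose H := [set f | (f \notin S) && (4 * D < x f)].
have [S0|Sne] := eqVneq S set0.
  rewrite [X in _ + X]big1 ?addr0; last first.
    move=> f _; rewrite /x big1 ?mulr0 // => i _.
    by case: (boolP (far_larger _ _ _ _ _)) => // /existsP[e]; rewrite S0 inE.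
  apply: (le_trans part1); rewrite ler_wpM2r // ler_wpM2r // ler_nat //.
have cSpos : 0 < #|S|%:R :> R by rewrite ltr0n card_gt0.
(* Otherwise [|S|] edges of [H] would total at least [4 D |S|], against the bound [2 D |S|] from
   [sum_far_larger]. *)
have cH : (#|H| < #|S|)%N.
  rewrite ltnNge; apply/negP => /card_geqP[sq [usq ssq subsq]].
  pose H' := [set f in sq].
  have cH' : #|H'| = #|S| by rewrite cardsE (card_uniqP usq).
  have : \sum_(f in H') x f <= D * (#|S|%:R + #|H'|%:R).
    by apply: sum_far_larger => //; rewrite cH'.
  apply/negP; rewrite -ltNge cH'.
  apply: (@lt_le_trans _ _ (\sum_(f in H') 4 * D)).
    rewrite sumr_const cH' -[_ *+ _]mulr_natl.
    by move: (mulr_gt0 D_gt0 cSpos); lra.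
  by apply: ler_sum => f; rewrite inE => /subsq; rewrite inE => /andP[_ /ltW].
have cHK : #|H|%:R <= K by apply: le_trans cS; rewrite ler_nat ltnW.
have part2 : \sum_(f | f \notin S) `|h f| * x f <= N1 / K * \sum_(f in H) x f + 4 * D * N1.
  rewrite !mulr_sumr big_mkcond [X in _ <= X + _]big_mkcond -big_split.
  apply: ler_sum => f _ /=.
  have -> : (f \in H) = (f \notin S) && (4 * D < x f) by rewrite in_set.
  have v0 : 0 <= N1 / K by rewrite divr_ge0 // ltW.
  have D4 : 0 <= 4 * D * `|h f| by rewrite mulr_ge0 // mulr_ge0.
  case: (boolP (f \in S)) => hf /=; first by rewrite add0r.
  case: ltP => hx.
    rewrite -[leLHS]addr0 lerD // ler_wpM2r //.
    by move: hf; rewrite inE -leNgt.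
  by rewrite add0r mulrC ler_wpM2r.
have hH : \sum_(f in H) x f <= D * (#|S|%:R + #|H|%:R) by apply: sum_far_larger.
have part3 : N1 / K * \sum_(f in H) x f <= 2 * D * N1.
  apply: (@le_trans _ _ (N1 / K * (D * (K + K)))).
    rewrite ler_wpM2l ?divr_ge0 ?(ltW K_gt0) //; apply: (le_trans hH).
    by rewrite ler_wpM2l // lerD.
  by rewrite le_eqVlt; apply/orP; left; apply/eqP; field; rewrite lt0r_neq0.
by move: part1 part2 part3; lra.
Qed.

End FarTotal.

(** * The null space property *)

Section Levels.
Variables (R : realType) (n : nat) (adj : rel 'I_n) (h : edge adj -> R).

Lemma card_exceed_le b (tau tau' : R) : tau' <= tau ->
  (#|exceed h b tau| <= #|exceed h b tau'|)%N.
Proof.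
move=> ht; apply: subset_leq_card; apply/subsetP => e; rewrite !inE.
exact: le_lt_trans.
Qed.

Lemma card_exceed_sum (tau : R) : 0 <= tau ->
  \sum_(b : bool) #|exceed h b tau|%:R = \sum_e (tau < `|h e|)%R%:R :> R.
Proof.
move=> tau0; under eq_bigr => b _ do rewrite -sum1_card natr_sum big_mkcond.
rewrite exchange_big; apply: eq_bigr => e _ /=.
rewrite big_bool /= !inE.
case: (lerP 0 (h e)) => he.
  rewrite (_ : (tau < - h e) = false) /= ?addr0; first by rewrite ger0_norm //; case: (tau < h e).
  by apply/negbTE; rewrite -leNgt; apply: le_trans tau0; rewrite oppr_le0.
rewrite (_ : (tau < h e) = false) /= ?add0r; first by rewrite ltr0_norm //; case: (tau < - h e).
by apply/negbTE; rewrite -leNgt; apply: le_trans tau0; exact: ltW.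
Qed.

(** Exchange the sums: an edge is counted only at levels below [|h e| / delta], and these form a
    geometric sum. Lowering both thresholds to [delta] times the level costs a factor 2. *)
Lemma card_exceed_levels (tau0 delta : R) J : 0 < tau0 -> 0 < delta -> delta <= 1 ->
  \sum_(j < J) \sum_(b : bool) level tau0 j *
    (#|exceed h b (level tau0 j)|%:R + #|exceed h (~~ b) (delta * level tau0 j)|%:R)
  <= 4 * (\sum_e `|h e|) / delta.
Proof.
move=> t0 d0 d1.
have lev0 j : 0 < level tau0 j by rewrite mulr_gt0 // exprn_gt0.
apply: (@le_trans _ _ (\sum_(j < J) level tau0 j *
    (2 * \sum_e (delta * level tau0 j < `|h e|)%R%:R))).
  apply: ler_sum => j _; rewrite -mulr_sumr ler_pM2l //.
  rewrite -card_exceed_sum; last by apply: mulr_ge0; exact: ltW.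
  rewrite !big_bool /=.
  have le b : #|exceed h b (level tau0 j)|%:R <= #|exceed h b (delta * level tau0 j)|%:R :> R.
    by rewrite ler_nat card_exceed_le // ler_piMl // ltW.
  by have := le true; have := le false; lra.
rewrite (eq_bigr (fun j : 'I_J => \sum_e 2 * (2 ^+ j * tau0 * (delta * level tau0 j < `|h e|)%R%:R))); last first.
  by move=> j _; rewrite mulrCA mulr_sumr mulr_sumr; apply: eq_bigr => e _.
rewrite exchange_big mulr_sumr mulr_suml; apply: ler_sum => e _ /=.
rewrite -mulr_sumr.
apply: (@le_trans _ _ (2 * (2 * (`|h e| / delta)))); last first.
  by rewrite le_eqVlt; apply/orP; left; apply/eqP; rewrite !mulrA -natrM.
rewrite ler_pM2l //.
apply: (@geometric_sum_le R tau0 (`|h e| / delta) J (fun j => delta * level tau0 j < `|h e|)).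
- exact: ltW.
- by rewrite divr_ge0 // ltW.
- by move=> j _ hj; rewrite ler_pdivlMr // mulrC ltW.
Qed.

End Levels.

(** * From the two counting bounds to the null space property *)

Section Recovery.
Variables (R : realType) (n : nat) (adj : rel 'I_n).
Hypothesis adj_simple : simple_graph adj.
Hypothesis deg_gt0 : forall v, (0 < deg adj v)%N.
Local Notation label := (option (edge adj)).
Local Notation E := ((nedges adj)%:R : R).
Local Notation steps k := (nseq k (@one_label R n adj)).
Local Notation statE := (@statE R n adj).

Variables (B t m : nat) (d lam kap eta eps beta beta' Cm k Lam : R).
Hypothesis mixing : forall k v (F : {set edge adj}), (B <= k)%N ->
  transfer (steps k) (hit_prob R F) v <= 2 * #|F|%:R / E.
Hypothesis E_gt0 : 0 < E.
Hypothesis t_gt0 : (0 < t)%N.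
Hypothesis m_gt0 : (0 < m)%N.
Hypothesis d_def : 4 * (2 * B).+1%:R * (2 * d) = 1.
Hypothesis d_gt0 : 0 < d.
Hypothesis lam_def : lam * d ^+ B.+1 = 1.
Hypothesis kap_gt0 : 0 < kap.
Hypothesis kap_def : 96 * lam * B.+1%:R ^+ 2 * kap = d.
Hypothesis eta_def : 32 * lam * B.+1%:R * eta = kap.
Hypothesis eps_def : 8192 * eps = eta.
Hypothesis beta'_gt0 : 0 < beta'.
Hypothesis beta_def : 4 * lam * beta = 2 * d * beta'.
Hypothesis Cm_def : 512 <= Cm * (2 * d) * eta.
Hypothesis k_gt0 : 0 < k.
Hypothesis t_large : E <= t%:R * k.
Hypothesis t_small : 8 * t%:R * (beta' * k) <= E.
Hypothesis Lam_ge0 : 0 <= Lam.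
Hypothesis m_large : Cm * k * Lam <= m%:R.

Variables (ls : 'I_m -> seq label) (A : 'I_m -> edge adj -> nat).
Hypothesis A_supp : forall i e, (0 < A i e)%N = (Some e \in ls i).
Hypothesis A_le2 : forall i e, (A i e <= 2)%N.
Hypothesis many_hits : forall U N : {set edge adj},
  (m%:R * statE t (fun s => (hit_avoid U N s)%:R) - 16 * (#|U|%:R + #|N|%:R) * Lam) / 4 <=
  \sum_i (hit_avoid U N (ls i))%:R.
Hypothesis few_far : forall X F : {set edge adj},
  #|X|%:R <= beta' * k -> #|F|%:R <= beta' * k ->
  \sum_i (far_count B X F (ls i))%:R <= eps * m%:R * t%:R / E * (#|X|%:R + #|F|%:R).

Lemma null_space_property (h : edge adj -> R) (S0 : {set edge adj}) :
  (forall i, \sum_e (A i e)%:R * h e = 0) -> #|S0|%:R <= beta * k ->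
  \sum_e `|h e| <= 2 * \sum_(e in S0) `|h e| -> forall e, h e = 0.
Proof.
move=> hker cS0 hS0.
pose N1 := \sum_e `|h e|.
have N1ge : 0 <= N1 by apply: sumr_ge0.
suff N10 : N1 = 0.
  move=> e; apply/eqP; rewrite -normr_eq0; apply/eqP.
  by apply: (psumr_eq0P _ N10) => // *.
apply/eqP; apply: contraT => N1ne; exfalso.
have N1gt : 0 < N1 by rewrite lt0r N1ne.
have L1 : 1 <= B.+1%:R :> R by rewrite ler1n.
have lam_gt0 : 0 < lam by rewrite -(pmulr_lgt0 _ (exprn_gt0 B.+1 d_gt0)) lam_def.
have delta1 : 2 * d <= 1.
  have : 1 <= 4 * (2 * B).+1%:R :> R by rewrite -natrM ler1n.
  by move: d_def d_gt0; move: (4 * _) => x; nra.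
have lam1 : 1 <= lam.
  rewrite -[X in X <= _]lam_def ler_piMr ?(ltW lam_gt0) // exprn_ile1 ?(ltW d_gt0) //.
  by move: delta1 d_gt0; lra.
have lamL : 0 < lam * B.+1%:R by rewrite mulr_gt0.
have Lne : 1 + B%:R != 0 :> R by rewrite addrC natr1 pnatr_eq0.
have lamne := lt0r_neq0 lam_gt0; have Ene := lt0r_neq0 E_gt0; have dne := lt0r_neq0 d_gt0.
have kapne := lt0r_neq0 kap_gt0.
have eta_gt0 : 0 < eta.
  have p : 0 < 32 * lam * B.+1%:R by rewrite !mulr_gt0.
  by rewrite -(pmulr_rgt0 _ p) eta_def.
have eps_gt0 : 0 < eps by move: eps_def; lra.
pose K := beta' * k.
have K_gt0 : 0 < K by rewrite mulr_gt0.
pose v0 := N1 / K.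
have v0gt : 0 < v0 by rewrite divr_gt0.
(* Then even the avoidance threshold of the lowest level is [v0], so every edge set in play only
   sees values above [v0]. *)
pose tau0 := v0 / (2 * d).
have tau0gt : 0 < tau0 by rewrite divr_gt0 // mulr_gt0.
have dtau : 2 * d * tau0 = v0.
  by rewrite /tau0 mulrC mulfVK // lt0r_neq0 // mulr_gt0.
have v0tau : v0 <= tau0 by rewrite -dtau ler_piMl // ltW.
pose S := top_set h K.
have cS : #|S|%:R <= K := top_set_card h K_gt0.
(* The expectation bound needs a small support. By [trunc] the truncation changes none of the level
   sets. *)
pose h' e := if e \in S then h e else 0.
have inS e : (e \in S) = (v0 < `|h e|) by rewrite inE.
have lev_ge j : tau0 <= level tau0 j by rewrite ler_peMl ?exprn_ege1 ?ler1n // ltW.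
have trunc b tau : v0 <= tau -> exceed h' b tau = exceed h b tau.
  move=> hv; apply/setP => e; rewrite [LHS]in_set [RHS]in_set /h'.
  case: (boolP (e \in S)) => // heS; have he : `|h e| <= v0 by rewrite leNgt -inS.
  rewrite oppr0 if_same; transitivity false.
    by apply/negbTE; rewrite -leNgt; apply: le_trans hv; exact: ltW.
  apply/esym/negbTE; rewrite -leNgt; apply: le_trans hv; apply: le_trans he.
  by case: b; [exact: ler_norm|rewrite -normrN ler_norm].
have [J hJ] : exists J, N1 <= level tau0 J.
  exists (Num.bound (N1 / tau0)); rewrite -ler_pdivrMr //.
  apply: (@le_trans _ _ (Num.bound (N1 / tau0))%:R).
    by apply/ltW/archi_boundP; rewrite divr_ge0 // ltW.
  by rewrite -natrX ler_nat ltnW // ltn_expl.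
have h'le e : `|h' e| <= `|h e| by rewrite /h'; case: ifP => // _; rewrite normr0.
have hJ' e : `|h' e| <= level tau0 J.
  apply: (le_trans (h'le e)); apply: le_trans hJ.
  by rewrite /N1 (bigD1 e) //= lerDl sumr_ge0.
have supp' e : h' e != 0 -> e \in S by rewrite /h'; case: ifP => // _; rewrite eqxx.
have small' : 8 * t%:R * #|S|%:R <= E.
  by apply: le_trans t_small; rewrite ler_wpM2l // mulr_ge0.
have kap1 : 2 * kap <= 1.
  suff : kap <= d by move: delta1; lra.
  rewrite -kap_def ler_peMl ?(ltW kap_gt0) //.
  have LL : 1 <= B.+1%:R ^+ 2 :> R by rewrite exprn_ege1.
  have : 1 <= lam * B.+1%:R ^+ 2 by rewrite -[leLHS]mulr1; apply: ler_pM.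
  by rewrite -mulrA; lra.
have nugt : 0 < N1 / E by rewrite divr_gt0.
have := level_stat adj_simple deg_gt0 mixing E_gt0 small' supp' d_gt0 delta1 tau0gt nugt
  kap_gt0 kap1 t_gt0 lam_def hJ'.
set mass := \sum_e _ * _; set N1' := \sum_e `|h' e|; set Pr := \sum_(j < J) _ => hPr.
have N1'le : N1' <= N1 by apply: ler_sum.
(* Half of the mass lies on [S0]; by the choice of [beta], edges of [S0] below [lam * tau0] carry at
   most [N1 / 4] of it. *)
have hmass : N1 / 4 <= mass.
  have : \sum_(e in S0) `|h e| <= mass + #|S0|%:R * (lam * tau0).
    rewrite mulr_natl -sumr_const big_mkcond /mass [X in _ <= _ + X]big_mkcond -big_split.
    apply: ler_sum => e _ /=.
    have m0 : 0 <= `|h' e| * (lam * tau0 < `|h' e|)%R%:R by rewrite mulr_ge0.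
    have lt0 : 0 < lam * tau0 by rewrite mulr_gt0.
    case: (e \in S0); last by rewrite addr0.
    case: (ltP (lam * tau0) `|h e|) => he; last by rewrite -[leLHS]add0r lerD.
    rewrite (_ : h' e = h e) ?he ?mulr1 ?lerDl ?(ltW lt0) //.
    rewrite /h' inS (le_lt_trans v0tau) //; apply: le_lt_trans he.
    by rewrite ler_peMl // ltW.
  have : #|S0|%:R * (lam * tau0) <= N1 / 4.
    apply: (@le_trans _ _ (beta * k * (lam * tau0))).
      by rewrite ler_wpM2r // mulr_ge0 // ltW.
    rewrite le_eqVlt; apply/orP; left; apply/eqP.
    have h4 : 4 != 0 :> R by rewrite pnatr_eq0.
    apply: (mulfI h4); rewrite [RHS]mulrCA mulfV // mulr1.
    transitivity (4 * lam * beta * k * tau0); first by ring.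
    rewrite beta_def; transitivity (2 * d * tau0 * (beta' * k)); first by ring.
    by rewrite dtau /v0 mulfVK // lt0r_neq0.
  by move: hS0; rewrite -/N1; lra.
(* With [nu = N1 / E], the choice of [kap] makes the subtracted term at most half of the main one;
   [eta] is the constant that survives. *)
have lower : eta * t%:R * N1 / E <= 4 * Pr.
  apply: le_trans hPr.
  rewrite (_ : eta * _ * _ / _ = t%:R * (kap / 2 * (N1 / E / (16 * (lam * B.+1%:R))))); last first.
    by rewrite -eta_def; field; rewrite Lne lamne Ene.
  rewrite ler_pM2l ?ltr0n // ler_pM2l ?divr_gt0 //.
  have m1 : N1 / 4 / (2 * E) / (lam * B.+1%:R) <= mass / (2 * E) / (lam * B.+1%:R).
    by rewrite !ler_pM2r // invr_gt0 // mulr_gt0.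
  have m2 : 2 * kap / d * (2 * B.+1%:R * N1' / E + N1 / E) <=
     2 * kap / d * (3 * B.+1%:R * N1 / E).
    rewrite ler_pM2l; last by rewrite divr_gt0 // mulr_gt0.
    rewrite -mulrDl ler_pM2r ?invr_gt0 //.
    have : B.+1%:R * N1' <= B.+1%:R * N1 by rewrite ler_pM2l.
    have : N1 <= B.+1%:R * N1 by rewrite ler_peMl.
    by rewrite -!mulrA; lra.
  have m3 : 2 * kap / d * (3 * B.+1%:R * N1 / E) = N1 / E / (16 * (lam * B.+1%:R)).
    by rewrite -kap_def; field; rewrite ?Lne ?lamne ?Ene ?dne ?kapne.
  have m4 : N1 / 4 / (2 * E) / (lam * B.+1%:R) = 2 * (N1 / E / (16 * (lam * B.+1%:R))).
    by field; rewrite ?Lne ?lamne ?Ene ?dne ?kapne.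
  rewrite m3 in m2; rewrite m4 in m1.
  apply: le_trans (lerB m1 m2).
  by move: (N1 / E / _) => x; lra.
pose U b (j : nat) := exceed h b (level tau0 j).
pose N b (j : nat) := exceed h (~~ b) (2 * d * level tau0 j).
pose cnt b j : R := \sum_i (hit_avoid (U b j) (N b j) (ls i))%:R.
have lev0 j : 0 < level tau0 j by exact: lt_le_trans (lev_ge j).
have upper : \sum_(j < J) \sum_(b : bool) level tau0 j * cnt b j
   <= 128 * (eps * m%:R * t%:R / E) * N1.
  have D_gt0 : 0 < eps * m%:R * t%:R / E.
    by apply: divr_gt0 => //; rewrite !mulr_gt0 // ltr0n.
  have := far_mass_total h K_gt0 D_gt0 few_far; rewrite -/S -/N1 => hfar.
  apply: (@le_trans _ _ (16 * \sum_i far_mass B h S (ls i))); last by lra.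
  rewrite mulr_sumr /cnt.
  under eq_bigr => j _ do under eq_bigr => b _ do rewrite mulr_sumr.
  under eq_bigr => j _ do rewrite exchange_big.
  rewrite exchange_big; apply: ler_sum => i _ /=.
  rewrite exchange_big big_bool /=.
  have step b : \sum_(j < J) level tau0 j * (hit_avoid (U b j) (N b j) (ls i))%:R <=
      8 * far_mass B h S (ls i).
    apply: (@compensation_levels R n adj B h S (A i)) => //; first by rewrite mulr_gt0.
    by move=> e he; rewrite inS; exact: le_lt_trans he.
  by have := step true; have := step false; lra.
have cards := card_exceed_levels h J tau0gt (mulr_gt0 (ltr0n R 2) d_gt0) delta1.
rewrite -/N1 in cards.
pose C := \sum_(j < J) \sum_(b : bool) level tau0 j * (#|U b j|%:R + #|N b j|%:R).
have cardsC : C <= 4 * N1 / (2 * d) by exact: cards.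
have comb : m%:R / 4 * Pr - 4 * Lam * C <= 128 * (eps * m%:R * t%:R / E) * N1.
  apply: le_trans upper.
  rewrite /Pr /C !mulr_sumr -sumrB; apply: ler_sum => j _.
  rewrite !mulr_sumr -sumrB; apply: ler_sum => b _.
  have v0l : v0 <= level tau0 j by exact: le_trans (lev_ge j).
  have v0dl : v0 <= 2 * d * level tau0 j by rewrite -dtau ler_pM2l // mulr_gt0.
  rewrite !trunc // -/(U b j) -/(N b j).
  apply: le_trans (_ : level tau0 j * ((m%:R * statE t (fun s => (hit_avoid (U b j) (N b j) s)%:R) -
     16 * (#|U b j|%:R + #|N b j|%:R) * Lam) / 4) <= _); last first.
    by rewrite ler_pM2l //; exact: many_hits.
  by rewrite le_eqVlt; apply/orP; left; apply/eqP; field.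
(* The main term is at least [eta Q / 16], the union bound loses at most [eta Q / 32] by [Cm_def],
   and the far mass allows only [eta Q / 64] by [eps_def], which is absurd. *)
pose Q := m%:R * t%:R * N1 / E.
have Qgt : 0 < Q by apply: divr_gt0 => //; rewrite !mulr_gt0 // ltr0n.
have hLam : 16 * Lam * N1 / (2 * d) <= eta * Q / 32.
  have h1 : 512 * Lam <= Cm * Lam * (2 * d) * eta.
    by have := ler_wpM2r Lam_ge0 Cm_def; lra.
  have h2 : Cm * Lam <= m%:R * t%:R / E.
    rewrite ler_pdivlMr // -(ler_pM2r k_gt0).
    apply: (@le_trans _ _ (m%:R * E)).
      rewrite (_ : Cm * Lam * E * k = Cm * k * Lam * E); last by ring.
      by rewrite ler_pM2r.
    by rewrite -mulrA ler_pM2l // ltr0n.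
  have h3 : 512 * Lam <= m%:R * t%:R / E * (2 * d) * eta.
    apply: (le_trans h1); rewrite ler_pM2r // ler_pM2r // mulr_gt0 //.
  have -> : eta * Q / 32 = m%:R * t%:R / E * eta * N1 / 32 by rewrite /Q; field; rewrite ?Ene ?dne.
  rewrite ler_pdivrMr ?mulr_gt0 //.
  have := ler_wpM2r N1ge h3; lra.
have hC : 4 * Lam * C <= 16 * Lam * N1 / (2 * d).
  have := ler_wpM2l (mulr_ge0 (ler0n R 4) Lam_ge0) cardsC.
  by rewrite (_ : 4 * Lam * (4 * N1 / (2 * d)) = 16 * Lam * N1 / (2 * d)); last by field; rewrite ?Ene ?dne.
have hlow : eta * Q / 16 <= m%:R / 4 * Pr.
  have := ler_wpM2l (ler0n R m) lower.
  rewrite (_ : m%:R * (eta * t%:R * N1 / E) = eta * Q); last by rewrite /Q; field; rewrite ?Ene ?dne.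
  by lra.
have hup : 128 * (eps * m%:R * t%:R / E) * N1 = eta * Q / 64.
  by rewrite -eps_def /Q; field; rewrite ?Ene ?dne.
by have := mulr_gt0 eta_gt0 Qgt; move: comb hC hLam hlow; rewrite hup; lra.
Qed.

End Recovery.

(** * Independent walks *)

Lemma sum_tuple_cons (R : realType) (T : finType) (t : nat) (F : seq T -> R) :
  \sum_(s : t.+1.-tuple T) F s = \sum_(x : T) \sum_(s : t.-tuple T) F (x :: s).
Proof.
rewrite pair_big /= (reindex (fun p : T * t.-tuple T => [tuple of p.1 :: p.2])) //=.
exists (fun s : t.+1.-tuple T => (thead s, [tuple of behead s])).
  by case=> x s _; rewrite theadE; congr pair; apply: val_inj.
by move=> s _; case/tupleP: s => x s; rewrite theadE; apply: val_inj.
Qed.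

Lemma sum_exp_card (R : realType) (T : finType) (x : R) :
  \sum_(U : {set T}) x ^+ #|U| = (1 + x) ^+ #|T|.
Proof.
rewrite -prodr_const -[in RHS](addrC x) bigA_distr; apply: eq_bigr => U _.
by rewrite -big_mkcond prodr_const.
Qed.

Section Sampling.
Variables (R : realType) (n : nat) (adj : rel 'I_n).
Hypothesis adj_simple : simple_graph adj.
Hypothesis deg_gt0 : forall v, (0 < deg adj v)%N.
Local Notation label := (option (edge adj)).
Local Notation E := ((nedges adj)%:R : R).
Local Notation steps k := (nseq k (@one_label R n adj)).
Local Notation statE := (@statE R n adj).
Local Notation walkE := (@walkE R n adj).
Local Notation weight := (@walk_weight R n adj).
Hypothesis E_gt0 : 0 < E.

Definition labels (s : seq 'I_n) : seq label :=
  if s is x :: s' then pairmap (@edge_label n adj) x s' else [::].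

Lemma sum_walk_weight t (f : seq label -> R) :
  \sum_(s : t.+1.-tuple 'I_n) weight s * f (labels s) = statE t f.
Proof.
rewrite (sum_tuple_cons t (fun s => weight s * f (labels s))).
apply: eq_bigr => x _ /=.
under eq_bigr => s _ do rewrite -mulrA.
rewrite -mulr_sumr; congr (_ * _).
elim: t x f => [|t IH] x f /=.
  rewrite (bigD1 [tuple]) //= big_nil mul1r big1 ?addr0 // => s.
  by rewrite tuple0.
rewrite (sum_tuple_cons t (fun s => (\prod_(p <- zip (x :: s) s) trans R adj p.1 p.2) *
  f (pairmap (@edge_label n adj) x s))).
apply: eq_bigr => u _; rewrite -IH mulr_sumr; apply: eq_bigr => s _ /=.
by rewrite big_cons -mulrA.
Qed.

Lemma sum_walks m t (f : seq label -> R) :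
  \sum_(ws : {ffun 'I_m -> t.+1.-tuple 'I_n})
    (\prod_(i < m) weight (ws i)) * \prod_(i < m) f (labels (ws i)) = statE t f ^+ m.
Proof.
rewrite -[in RHS](card_ord m) -prodr_const -sum_walk_weight.
rewrite (bigA_distr_bigA (fun _ (s : t.+1.-tuple 'I_n) => weight s * f (labels s))).
by apply: eq_bigr => ws _; rewrite big_split.
Qed.

Lemma sum_stat : \sum_v stat R adj v = 1.
Proof.
have Ene := lt0r_neq0 E_gt0.
by rewrite -mulr_suml sum_deg // divff // mulf_neq0 // pnatr_eq0.
Qed.

Lemma statE_cst l a : statE l (fun=> a) = a.
Proof.
rewrite /statE; under eq_bigr => v _ do rewrite walkE_cst //.
by rewrite -mulr_suml sum_stat mul1r.
Qed.

Lemma weight_ge0 s : 0 <= weight s.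
Proof.
case: s => [|x s] //=; rewrite mulr_ge0 ?stat_ge0 // prodr_ge0 // => p _.
exact: trans_ge0.
Qed.

Lemma weight_is_walk s : weight s != 0 -> is_walk adj s.
Proof.
case: s => [|x s] //=; rewrite mulf_eq0 negb_or => /andP[_].
elim: s x => [|y s IH] x //=; rewrite big_cons mulf_eq0 negb_or => /andP[h /IH ->].
rewrite andbT; move: h; rewrite /trans /=; case: adj => //.
by rewrite mul0r eqxx.
Qed.

(** Markov's inequality with a union bound: independence makes [c a * statE t (f a) ^+ m] the mean
    of the statistic with index [a], and failure of recovery forces some statistic to reach 1.
    Samples that are not walks have weight 0. *)
Lemma success_prob_ge (reg : seq 'I_n -> seq 'I_n) m t (sp : R)
    (I : finType) (c : I -> R) (f : I -> seq label -> R) :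
  (forall i, 0 <= c i) -> (forall i s, 0 <= f i s) ->
  (forall ws : {ffun 'I_m -> t.+1.-tuple 'I_n}, (forall i, is_walk adj (ws i)) ->
     (forall a, c a * \prod_(i < m) f a (labels (ws i)) < 1) ->
     l1_recovers (@meas_matrix R n adj reg m t ws) sp) ->
  1 - \sum_a c a * statE t (f a) ^+ m <= success_prob adj reg m t sp.
Proof.
move=> c0 f0 hrec.
pose W (ws : {ffun 'I_m -> t.+1.-tuple 'I_n}) := \prod_(i < m) weight (ws i).
have W0 ws : 0 <= W ws by apply: prodr_ge0 => i _; exact: weight_ge0.
have tot : \sum_ws W ws = 1.
  have := sum_walks m t (fun=> 1); rewrite statE_cst expr1n => <-.
  by apply: eq_bigr => ws _; rewrite prodr_const expr1n mulr1.
have -> : 1 - \sum_a c a * statE t (f a) ^+ m =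
  \sum_ws W ws * (1 - \sum_a c a * \prod_(i < m) f a (labels (ws i))).
  under [RHS]eq_bigr => ws _ do rewrite mulrBr mulr1 mulr_sumr.
  rewrite sumrB tot exchange_big; congr (_ - _); apply: eq_bigr => a _ /=.
  rewrite -sum_walks mulr_sumr; apply: eq_bigr => ws _; exact: mulrCA.
rewrite /success_prob [leRHS]big_mkcond /=; apply: ler_sum => ws _.
have term0 a : 0 <= c a * \prod_(i < m) f a (labels (ws i)).
  by rewrite mulr_ge0 // prodr_ge0.
case: (boolP `[< _ >]) => hr.
  by rewrite ler_piMr // lerBlDr lerDl sumr_ge0.
have [->|Wne] := eqVneq (W ws) 0; first by rewrite mul0r.
rewrite mulr_ge0_le0 // subr_le0 leNgt; apply/negP => hlt.
move/negP: hr; apply; apply/asboolP; apply: hrec.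
  move=> i; apply: weight_is_walk; move: Wne; apply: contraNneq => h0.
  by rewrite /W (bigD1 i) //= h0 mul0r.
move=> a; apply: le_lt_trans hlt; rewrite (bigD1 a) //= lerDl sumr_ge0 //.
Qed.

End Sampling.

(** Take [h = y - x] and [S0] the support of [x]. Off [S0], [h] equals [y], so if [y] has no larger
    norm than [x], the triangle inequality on [S0] puts half the mass of [h] there. *)
Lemma l1_recovers_null_space (R : realType) (n : nat) (adj : rel 'I_n) m
    (A : 'I_m -> edge adj -> R) (s : R) :
  (forall (h : edge adj -> R) (S0 : {set edge adj}),
    (forall i, \sum_e A i e * h e = 0) -> #|S0|%:R <= s ->
    \sum_e `|h e| <= 2 * \sum_(e in S0) `|h e| -> forall e, h e = 0) ->
  l1_recovers A s.
Proof.
move=> nsp x hx y hA [e0 he0]; rewrite ltNge; apply/negP => hyx.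
move/eqP: he0; apply; apply/eqP; rewrite -subr_eq0; apply/eqP.
pose S0 := [set e | x e != 0].
apply: (nsp (fun e => y e - x e) S0).
- move=> i; under eq_bigr => e _ do rewrite mulrBr.
  by rewrite sumrB hA subrr.
- by rewrite cardsE.
move: hyx; rewrite /l1norm (bigID (mem S0)) [X in _ <= X -> _](bigID (mem S0)) /=.
rewrite [X in _ <= _ + X -> _]big1; last first.
  by move=> e; rewrite inE negbK => /eqP ->; rewrite normr0.
rewrite addr0 [X in _ -> X <= _](bigID (mem S0)) /=.
have -> : \sum_(e | e \notin S0) `|y e - x e| = \sum_(e | e \notin S0) `|y e|.
  by apply: eq_bigr => e; rewrite inE negbK => /eqP ->; rewrite subr0.
have : \sum_(e in S0) `|x e| <= \sum_(e in S0) `|y e - x e| + \sum_(e in S0) `|y e|.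
  rewrite -big_split; apply: ler_sum => e _ /=.
  by rewrite -{1}[x e](subrK (y e)) (le_trans (ler_normD _ _)) // distrC.
by lra.
Qed.

(** * Concentration and the union bound over pairs of edge sets *)

Section GraphRecovery.
Variables (R : realType) (n : nat) (adj : rel 'I_n).
Hypothesis adj_simple : simple_graph adj.
Hypothesis deg_gt0 : forall v, (0 < deg adj v)%N.
Local Notation label := (option (edge adj)).
Local Notation E := ((nedges adj)%:R : R).
Local Notation steps k := (nseq k (@one_label R n adj)).
Local Notation statE := (@statE R n adj).

Variables (B t m : nat) (d lam kap eta eps beta beta' theta Cm k Lam : R).
Hypothesis mixing : forall k v (F : {set edge adj}), (B <= k)%N ->
  transfer (steps k) (hit_prob R F) v <= 2 * #|F|%:R / E.
Hypothesis E_gt0 : 0 < E.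
Hypothesis t_gt0 : (0 < t)%N.
Hypothesis m_gt0 : (0 < m)%N.
Hypothesis d_def : 4 * (2 * B).+1%:R * (2 * d) = 1.
Hypothesis d_gt0 : 0 < d.
Hypothesis lam_def : lam * d ^+ B.+1 = 1.
Hypothesis kap_gt0 : 0 < kap.
Hypothesis kap_def : 96 * lam * B.+1%:R ^+ 2 * kap = d.
Hypothesis eta_def : 32 * lam * B.+1%:R * eta = kap.
Hypothesis eps_def : 8192 * eps = eta.
Hypothesis eps_gt0 : 0 < eps.
Hypothesis beta'_gt0 : 0 < beta'.
Hypothesis beta_def : 4 * lam * beta = 2 * d * beta'.
Hypothesis Cm_def : 512 <= Cm * (2 * d) * eta.
Hypothesis theta_gt0 : 0 < theta.
Hypothesis theta_def : expR theta = 1 + (4 * B.+1%:R)^-1.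
Hypothesis Cm_theta : 8 <= theta * eps * Cm.
Hypothesis k_gt0 : 0 < k.
Hypothesis t_large : E <= t%:R * k.
Hypothesis t_small : 8 * t%:R * (beta' * k) <= E.
Hypothesis t_small' : 1024 * t%:R * (beta' * k) <= theta * eps * E.
Hypothesis Lam_ge0 : 0 <= Lam.
Hypothesis m_large : Cm * k * Lam <= m%:R.
Variable reg : seq 'I_n -> seq 'I_n.
Hypothesis reg_ok : regularization adj reg.

Let x : R := expR (- (4 * Lam)).
Let D : R := eps * m%:R * t%:R / E.

Let D_ge : 8 * Lam <= theta * D.
Proof.
have h2 : Cm * Lam <= m%:R * t%:R / E.
  rewrite ler_pdivlMr // -(ler_pM2r k_gt0).
  apply: (@le_trans _ _ (m%:R * E)).
    rewrite (_ : Cm * Lam * E * k = Cm * k * Lam * E); last by ring.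
    by rewrite ler_pM2r.
  by rewrite -mulrA ler_pM2l // ltr0n.
have te : 0 <= theta * eps by rewrite mulr_ge0 // ltW.
have h3 := ler_wpM2l te h2.
have h4 := ler_wpM2r Lam_ge0 Cm_theta.
apply: (le_trans h4); rewrite -[leLHS]mulrA; apply: (le_trans h3).
by rewrite /D !mulrA.
Qed.

Definition bad_coef (a : bool * ({set edge adj} * {set edge adj})) : R :=
  let: (b, (U, N)) := a in
  if b then
    if (0 < #|U| + #|N|)%N &&
       (16 * (#|U|%:R + #|N|%:R) * Lam <= m%:R * statE t (fun s => (hit_avoid U N s)%:R))
    then expR (m%:R * statE t (fun s => (hit_avoid U N s)%:R) / 4) else 0
  else
    if [&& (0 < #|U| + #|N|)%N, #|U|%:R <= beta' * k & #|N|%:R <= beta' * k]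
    then expR (- (theta * (D * (#|U|%:R + #|N|%:R)))) else 0.

Definition bad_fun (a : bool * ({set edge adj} * {set edge adj})) (s : seq label) : R :=
  let: (b, (U, N)) := a in
  if b then expR (- (hit_avoid U N s)%:R)
  else (1 + (4 * B.+1%:R)^-1) ^+ far_count B U N s.

Lemma bad_coef_ge0 a : 0 <= bad_coef a.
Proof. by case: a => [[] [U N]] /=; case: ifP => // _; exact: expR_ge0. Qed.

Lemma bad_fun_ge0 a s : 0 <= bad_fun a s.
Proof.
case: a => [[] [U N]] /=; first exact: expR_ge0.
by rewrite exprn_ge0 // addr_ge0 // invr_ge0 mulr_ge0.
Qed.

Lemma bad_bound a : bad_coef a * statE t (bad_fun a) ^+ m <=
  (0 < #|a.2.1| + #|a.2.2|)%N%:R * x ^+ (#|a.2.1| + #|a.2.2|).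
Proof.
have xge q : 0 <= x ^+ q by rewrite exprn_ge0 // expR_ge0.
case: a => [[] [U N]] /=.
  case: ifP => [/andP[-> hp]|_]; last by rewrite mul0r mulr_ge0.
  set p := statE t _ in hp *.
  have p0 : 0 <= p by apply: statE_ge0.
  have e2 : expR (-1) <= 2^-1 :> R.
    rewrite expRN lef_pV2 ?posrE ?expR_gt0 //.
    by have := expR_ge1Dx (1 : R); lra.
  (* The lower tail: [exp(-1) <= 1/2] makes the moment at most [1 - p/2], hence at most
     [exp(- p/2)]. *)
  have est : statE t (fun s => expR (- (hit_avoid U N s)%:R)) <= expR (- (p / 2)).
    apply: (@le_trans _ _ (1 - p / 2)); last first.
      by have := expR_ge1Dx (- (p / 2)); lra.
    apply: (@le_trans _ _ (statE t (fun s => 1 + (- 2^-1) * (hit_avoid U N s)%:R))).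
      apply: ler_statE => s _; case: hit_avoid; last by rewrite oppr0 expR0 mulr0 addr0.
      by apply: (le_trans e2); rewrite mulr1; lra.
    rewrite statED statEZ statE_cst // -/p; lra.
  apply: (@le_trans _ _ (expR (m%:R * p / 4) * expR (- (p / 2)) ^+ m)).
    rewrite ler_wpM2l ?expR_ge0 // lerXn2r ?nnegrE ?expR_ge0 //.
    by apply: (statE_ge0 deg_gt0) => s _; exact: expR_ge0.
  rewrite mul1r -expRM_natl -expRD /x -expRM_natl ler_expR natrD.
  by lra.
case: ifP => [/and3P[-> hU hN]|_]; last by rewrite mul0r mulr_ge0.
have small : 2 * t%:R * #|N|%:R <= E.
  have : t%:R * #|N|%:R <= t%:R * (beta' * k) by rewrite ler_wpM2l.
  have := t_small; have : 0 <= t%:R * #|N|%:R :> R by rewrite mulr_ge0.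
  by rewrite -!mulrA; lra.
have := far_mgf adj_simple deg_gt0 mixing small U.
set q := (_ / E ^+ 2) => hmgf.
(* Half of the exponent pays for the moment; by [D_ge] the other half is worth at least [4 * Lam]
   per edge of the two sets. *)
have hq : m%:R * q <= theta * (D * (#|U|%:R + #|N|%:R)) / 2.
  rewrite (_ : m%:R * q = (m%:R * t%:R / E * #|N|%:R / E) * (512 * t%:R * #|U|%:R)); last first.
    by rewrite /q; field; rewrite lt0r_neq0.
  have h1 : 512 * t%:R * #|U|%:R <= theta * eps * E / 2.
    have : t%:R * #|U|%:R <= t%:R * (beta' * k) by rewrite ler_wpM2l.
    by have := t_small'; rewrite -!mulrA; lra.
  have c0 : 0 <= m%:R * t%:R / E * #|N|%:R / E.
    by rewrite !(divr_ge0, mulr_ge0).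
  apply: (le_trans (ler_wpM2l c0 h1)).
  rewrite (_ : _ * (theta * eps * E / 2) = theta * (D * #|N|%:R) / 2); last first.
    by rewrite /D; field; rewrite lt0r_neq0.
  rewrite ler_pM2r ?invr_gt0 // ler_pM2l // ler_wpM2l ?lerDr //.
  by rewrite divr_ge0 // !mulr_ge0 // ltW.
apply: (@le_trans _ _ (expR (- (theta * (D * (#|U|%:R + #|N|%:R)))) * expR q ^+ m)).
  rewrite ler_wpM2l ?expR_ge0 // lerXn2r ?nnegrE ?expR_ge0 //.
    by apply: (statE_ge0 deg_gt0) => s _; rewrite exprn_ge0 // addr_ge0 // invr_ge0 mulr_ge0.
  by apply: (le_trans hmgf); exact: expR_ge1Dx.
rewrite mul1r -expRM_natl -expRD /x -expRM_natl ler_expR natrD.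
have UN0 : 0 <= #|U|%:R + #|N|%:R :> R by rewrite addr_ge0.
have := ler_wpM2r UN0 D_ge.
by lra.
Qed.

(** Summing a power of [x] over all subsets is a binomial expansion. The subtracted 1 is the empty
    pair, and the factor 2 counts the two kinds of failure. *)
Lemma bad_total : \sum_a bad_coef a * statE t (bad_fun a) ^+ m <=
  2 * ((1 + x) ^+ (nedges adj + nedges adj) - 1).
Proof.
apply: (le_trans (ler_sum _ (fun a _ => bad_bound a))).
rewrite (eq_bigr (fun a => (fun p : {set edge adj} * {set edge adj} =>
  (0 < #|p.1| + #|p.2|)%N%:R * x ^+ (#|p.1| + #|p.2|)) a.2)) //.
rewrite -(pair_big predT predT (fun (b : bool) (p : {set edge adj} * {set edge adj}) =>
  (0 < #|p.1| + #|p.2|)%N%:R * x ^+ (#|p.1| + #|p.2|))) /= big_bool /=.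
suff -> : \sum_(p : {set edge adj} * {set edge adj})
    (0 < #|p.1| + #|p.2|)%N%:R * x ^+ (#|p.1| + #|p.2|) =
    (1 + x) ^+ (nedges adj + nedges adj) - 1 by rewrite mulr_natl mulr2n.
rewrite exprD -sum_exp_card big_distrlr /= pair_big /=.
rewrite [RHS](_ : _ = \sum_(p : {set edge adj} * {set edge adj}) x ^+ #|p.1| * x ^+ #|p.2| - 1) //.
rewrite (bigD1 (set0, set0)) //= [in RHS](bigD1 (set0, set0)) //= !cards0 addn0 ltnn mul0r add0r.
rewrite expr0 mulr1 [RHS]addrAC subrr add0r; apply: eq_bigr => -[U N] hne /=.
rewrite exprD (_ : (0 < _)%N) ?mul1r // lt0n addn_eq0 !cards_eq0.
by move: hne; rewrite xpair_eqE.
Qed.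

Lemma graph_recovery : 1 - 2 * ((1 + x) ^+ (nedges adj + nedges adj) - 1) <=
  success_prob adj reg m t (beta * k).
Proof.
apply: (@le_trans _ _ (1 - \sum_a bad_coef a * statE t (bad_fun a) ^+ m)).
  by rewrite lerD2l lerN2; exact: bad_total.
apply: success_prob_ge => //; [exact: bad_coef_ge0|exact: bad_fun_ge0|].
move=> ws hwalk hgood; apply: l1_recovers_null_space.
pose A (i : 'I_m) (e : edge adj) := traversals (reg (ws i)) e.
apply: (@null_space_property R n adj adj_simple deg_gt0 B t m d lam kap eta eps beta beta' Cm k Lam
  mixing E_gt0 t_gt0 m_gt0 d_def d_gt0 lam_def kap_gt0 kap_def eta_def eps_def beta'_gt0 beta_def
  Cm_def k_gt0 t_large t_small Lam_ge0 m_large (fun i => labels adj (ws i)) A).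
- move=> i e; have [_ /(_ e)[-> _]] := reg_ok (hwalk i).
  case: (ws i) => [[|v s] //= _]; by rewrite mem_pairmap_edge_label.
- by move=> i e; have [_ /(_ e)[_ ->]] := reg_ok (hwalk i).
- move=> U N; set p := statE t _; set cnt := \sum_i _.
  have cnt0 : 0 <= cnt by apply: sumr_ge0.
  rewrite leNgt; apply/negP => hlt.
  have hp : 16 * (#|U|%:R + #|N|%:R) * Lam < m%:R * p by lra.
  have UN : (0 < #|U| + #|N|)%N.
    rewrite lt0n addn_eq0; apply/negP => /andP[/eqP/cards0_eq U0 _].
    move: hp; rewrite /p (@eq_statE _ _ _ _ _ (fun=> 0)) ?statE_cst ?mulr0; last first.
    - by move=> s _; rewrite /hit_avoid U0 (eq_has (a2 := pred0)) ?has_pred0 // => -[e|] //=; rewrite inE.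
    - exact: E_gt0.
    - exact: deg_gt0.
    - exact: adj_simple.
    by rewrite ltNge mulr_ge0 ?mulr_ge0 ?addr_ge0.
  have := hgood (true, (U, N)); rewrite /= UN -/p (ltW hp) /=.
  rewrite -expR_sum sumrN -/cnt -expRD expR_lt1.
  have : 0 <= 16 * (#|U|%:R + #|N|%:R) * Lam by rewrite !mulr_ge0 ?addr_ge0.
  by lra.
- move=> X F hX hF; rewrite -/D leNgt; apply/negP => hlt.
  have XF : (0 < #|X| + #|F|)%N.
    rewrite lt0n addn_eq0; apply/negP => /andP[/eqP/cards0_eq X0 /eqP/cards0_eq F0].
    move: hlt; rewrite X0 F0 cards0 addr0 mulr0 big1 ?ltxx // => i _.
    rewrite /far_count (_ : [set f in set0 | _] = set0) ?cards0 //.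
    by apply/setP => f; rewrite !inE.
  have := hgood (false, (X, F)); rewrite /= XF hX hF /= -theta_def.
  under eq_bigr => i _ do rewrite -expRM_natl.
  rewrite -expR_sum -expRD expR_lt1 -mulr_suml.
  have := hlt; rewrite -(ltr_pM2l theta_gt0); lra.
Qed.

End GraphRecovery.

(** * Mixing time and the theorem *)

Section GraphFacts.
Variables (R : realType) (n : nat) (adj : rel 'I_n).
Hypothesis adj_simple : simple_graph adj.

Lemma nedges_le : (nedges adj <= n ^ 2)%N.
Proof.
rewrite /nedges card_sig (leq_trans (max_card _)) //.
by rewrite card_prod card_ord.
Qed.

Lemma connected_deg_gt0 : (1 < n)%N -> connected_graph adj -> forall v, (0 < deg adj v)%N.
Proof.
move=> n1 conn v.
have [w wv] : exists w, w != v.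
  pose i0 : 'I_n := Ordinal (ltnW n1); pose i1 : 'I_n := Ordinal n1.
  have [e|ne] := eqVneq i0 v; last by exists i0.
  by exists i1; rewrite -e.
case/connectP: (conn v w) wv => [[|u p] /= hp ->]; first by rewrite eqxx.
case/andP: hp => hvu _ _; rewrite /deg; apply/card_gt0P; exists u.
by rewrite inE.
Qed.

(** Two starting vertices give the same vertex mass 0 and 1, and its stationary value cannot be
    within [delta] of both. A positive mixing time means that the factor [T n] never reduces the
    number of walks. *)
Lemma mixing_time_gt0 (delta : R) : (1 < n)%N -> 2 * delta < 1 -> ~ mixes adj delta 0.
Proof.
move=> n1 hd mix.
pose i0 : 'I_n := Ordinal (ltnW n1); pose i1 : 'I_n := Ordinal n1.
have h1 : `|stat R adj i0 - 0| <= delta := mix i1 i0.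
have h2 : `|stat R adj i0 - 1| <= delta := mix i0 i0.
rewrite subr0 in h1; rewrite distrC in h2.
have := le_trans (ler_norm _) h1; have := le_trans (ler_norm _) h2.
by lra.
Qed.

Hypothesis deg_gt0 : forall v, (0 < deg adj v)%N.

(** An upper bound valid for every starting vertex survives averaging over an extra first step. *)
Lemma mixes_later (delta : R) T k : mixes adj delta T -> (T <= k)%N ->
  forall v u, walk_dist R adj k v u <= stat R adj u + delta.
Proof.
move=> mix; elim: k => [|k IH].
  rewrite leqn0 => /eqP T0 v u; subst T.
  by have := mix v u; rewrite distrC => /(le_trans (ler_norm _)); rewrite lerBlDl.
rewrite leq_eqVlt => /predU1P[T0 v u|hk v u].
  by have := mix v u; rewrite T0 distrC => /(le_trans (ler_norm _)); rewrite lerBlDl.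
rewrite walk_distSl.
apply: (@le_trans _ _ (\sum_w trans R adj v w * (stat R adj u + delta))).
  by apply: ler_sum => w _; rewrite ler_wpM2l ?trans_ge0 // IH.
by rewrite -mulr_suml sum_trans // mul1r.
Qed.

(** Uniformity gives every vertex stationary mass at least [1 / (c n)], which exceeds the mixing
    radius; so after mixing each vertex has at most twice its stationary mass. *)
Lemma uniform_mixing (D c : R) T B : 1 <= c -> (0 < n)%N -> (T <= B)%N ->
  uniform_graph adj D c -> mixes adj (1 / (2 * c * n%:R) ^+ 2) T ->
  forall k v (F : {set edge adj}), (B <= k)%N ->
  transfer (nseq k (@one_label R n adj)) (hit_prob R F) v <= 2 * #|F|%:R / (nedges adj)%:R.
Proof.
move=> c1 n0 TB unif mix k v F hk.
have n1 : 1 <= n%:R :> R by rewrite ler1n.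
have cn1 : 1 <= c * n%:R by rewrite -[leLHS]mulr1; apply: ler_pM.
have Dp : 0 < D.
  have [h1 h2] := unif v; have : 1 <= (deg adj v)%:R :> R by rewrite ler1n.
  by move=> h3; nra.
have E0 : 0 < (nedges adj)%:R :> R.
  rewrite -(pmulr_rgt0 _ (ltr0n R 2)) -sum_deg // (bigD1 v) //= ltr_pwDl ?ltr0n //.
  exact: sumr_ge0.
have hE : 2 * (nedges adj)%:R <= n%:R * (c * D).
  rewrite -sum_deg // -[n in n%:R]card_ord mulr_natl -sumr_const.
  by apply: ler_sum => u _; have [] := unif u.
have dstat (u : 'I_n) : 1 / (2 * c * n%:R) ^+ 2 <= stat R adj u.
  have [h1 _] := unif u.
  have cnp : 0 < 2 * c * n%:R by rewrite -mulrA; lra.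
  rewrite /stat ler_pdivlMr ?mulr_gt0 // mulrAC ler_pdivrMr ?exprn_gt0 // mul1r.
  apply: (le_trans hE); rewrite expr2.
  have -> : n%:R * (c * D) = D * (c * n%:R) by ring.
  apply: ler_pM => //; rewrite ?(ltW Dp) //; first by lra.
  have -> : 2 * c * n%:R * (2 * c * n%:R) = 4 * (c * n%:R) * (c * n%:R) by ring.
  by nra.
rewrite steps_walk_dist.
apply: (@le_trans _ _ (2 * \sum_w stat R adj w * hit_prob R F w)).
  rewrite mulr_sumr; apply: ler_sum => w _; rewrite mulrA ler_wpM2r ?hit_prob_ge0 //.
  apply: le_trans (mixes_later mix (leq_trans TB hk) v w) _.
  by have := dstat w; lra.
by rewrite stat_hit_prob // mulrA.
Qed.

End GraphFacts.

Lemma ceil_absz_bounds (R : realType) (x : R) : 0 <= x ->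
  x <= (absz (Num.ceil x))%:R <= x + 1.
Proof.
move=> x0; have c0 : 0 <= Num.ceil x by rewrite real_ceil_ge0 ?num_real //; lra.
have /andP[h1 h2] := real_ceil_itv (num_real x).
rewrite -[(absz _)%:R]/((absz (Num.ceil x))%:Z%:~R : R) gez0_abs // h2 /=.
by move: h1; rewrite intrB /=; lra.
Qed.

(** Here [x = n ^ -4] faces at most [2 n ^ 2] factors, so the power is at most [exp y] with
    [y <= 2 / n ^ 2]. *)
Lemma expR_pow_le (R : realType) (N n : nat) : (1 < n)%N -> (N <= n ^ 2)%N ->
  2 * ((1 + expR (- (4 * ln n%:R))) ^+ (N + N) - 1) <= 8 / n%:R :> R.
Proof.
move=> n1 hN.
have n2 : 2 <= n%:R :> R by rewrite ler_nat.
have np : 0 < n%:R :> R by lra.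
have -> : expR (- (4 * ln n%:R)) = (n%:R ^+ 4)^-1 :> R.
  by rewrite expRN expRM_natl lnK // posrE.
set x := (_ ^-1).
have x0 : 0 <= x by rewrite invr_ge0 exprn_ge0.
pose y := (N + N)%:R * x.
have y0 : 0 <= y by rewrite mulr_ge0.
have hy : y <= 2 / n%:R ^+ 2.
  apply: (@le_trans _ _ (2 * n%:R ^+ 2 * x)).
    rewrite ler_wpM2r // natrD mulr_natl mulr2n lerD // -natrX ler_nat //.
  by rewrite le_eqVlt; apply/orP; left; apply/eqP; rewrite /x; field; rewrite lt0r_neq0.
have nn : n%:R ^+ 2 >= 2 * n%:R :> R by rewrite expr2 ler_pM2r.
have hy' : y <= n%:R^-1.
  apply: (le_trans hy); rewrite ler_pdivrMr ?exprn_gt0 // mulrC ler_pdivlMr //.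
have ninv : n%:R^-1 <= 2^-1 :> R by rewrite lef_pV2 ?posrE.
have h1 : (1 + x) ^+ (N + N) <= expR y.
  rewrite /y expRM_natl lerXn2r ?nnegrE ?expR_ge0 ?addr_ge0 //; exact: expR_ge1Dx.
have h2 : expR y <= (1 - y)^-1.
  rewrite -[expR y]invrK -expRN lef_pV2 ?posrE ?expR_gt0 //; last by lra.
  exact: expR_ge1Dx.
have h3 : (1 - y)^-1 <= 1 + 2 * y.
  rewrite -[leLHS]mul1r ler_pdivrMr; last by lra.
  by nra.
have h4 := le_trans h1 (le_trans h2 h3).
move: hy' h4; rewrite -/y; move: (_ ^+ (N + N)) (n%:R^-1) => P q *; lra.
Qed.

Lemma mixing_radius_lt (R : realType) (c : R) (n : nat) : 1 <= c -> (1 < n)%N ->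
  2 * (1 / (2 * c * n%:R) ^+ 2) < 1.
Proof.
move=> c1 n1; have n2 : 2 <= n%:R :> R by rewrite ler_nat.
have cn : 4 <= 2 * c * n%:R by nra.
by rewrite mulrA mulr1 ltr_pdivrMr ?exprn_gt0 ?mul1r ?expr2; nra.
Qed.

Lemma exists_small_multiple (R : realType) (y : R) : 0 < y ->
  exists2 b : R, 0 < b & 2 * 8 * b <= 1 /\ 2 * 1024 * b <= y.
Proof.
move=> y0; exists (Num.min 16^-1 (y / 2048)).
  by rewrite lt_min invr_gt0 ltr0n divr_gt0.
have : Num.min 16^-1 (y / 2048) <= 16^-1 by rewrite ge_min lexx.
have : Num.min 16^-1 (y / 2048) <= y / 2048 by rewrite ge_min lexx orbT.
by move: (Num.min _ _) => b *; split; lra.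
Qed.

Theorem theorem9 (R : realType) (c : R) (adj : forall n : nat, rel 'I_n)
    (D : nat -> R) (T : nat -> nat) (N0 : nat) :
  1 <= c ->
  (forall n : nat, (N0 <= n)%N ->
     [/\ simple_graph (adj n), connected_graph (adj n),
         uniform_graph (adj n) (D n) c &
         is_mixing_time (adj n) (1 / (2 * c * n%:R) ^+ 2) (T n)]) ->
  (exists B : nat, forall n : nat, (N0 <= n)%N -> (T n <= B)%N) ->
  (forall M : R, exists N : nat, forall n : nat, (N <= n)%N -> M <= D n) ->
  exists Cm Ct beta : R, [/\ 0 < Cm, 0 < Ct, 0 < beta &
    forall (k : nat -> nat) (reg : forall n : nat, seq 'I_n -> seq 'I_n),
      (forall n : nat, (N0 <= n)%N -> (0 < k n <= nedges (adj n))%N) ->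
      (forall n : nat, regularization (adj n) (reg n)) ->
      forall eps : R, 0 < eps -> exists N : nat, forall n : nat, (N <= n)%N ->
        1 - eps <= success_prob (adj n) (reg n)
          (absz (Num.ceil (Cm * (T n)%:R * (k n)%:R * ln (n%:R : R))))
          (absz (Num.ceil (Ct * (nedges (adj n))%:R / (k n)%:R)))
          (beta * (k n)%:R)].
Proof.
move=> c1 hG [B hB] _.
(* All constants are fixed from [B] alone, before [k], [reg] and the error [eps]. *)
have [d d_gt0 d_def] : exists2 d : R, 0 < d & 4 * (2 * B).+1%:R * (2 * d) = 1.
  exists (8 * (2 * B).+1%:R)^-1; first by rewrite invr_gt0 mulr_gt0.
  have b0 : 8 * (2 * B).+1%:R != 0 :> R by rewrite lt0r_neq0 // mulr_gt0.
  rewrite -[RHS](mulfV b0) mulrCA mulrA; congr (_ * _); ring.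
have [lam lam_gt0 lam_def] : exists2 lam : R, 0 < lam & lam * d ^+ B.+1 = 1.
  by exists (d ^+ B.+1)^-1; rewrite ?invr_gt0 ?mulVf ?lt0r_neq0 ?exprn_gt0.
have quot (a b : R) : 0 < a -> 0 < b -> exists2 x, 0 < x & b * x = a.
  by move=> a0 b0; exists (a / b); rewrite ?divr_gt0 // mulrC mulfVK // lt0r_neq0.
have lamL : 0 < lam * B.+1%:R by rewrite mulr_gt0.
have [kap kap_gt0 kap_def] : exists2 kap : R, 0 < kap & 96 * lam * B.+1%:R ^+ 2 * kap = d.
  by apply: quot => //; rewrite mulr_gt0 ?exprn_gt0 // mulr_gt0.
have [eta eta_gt0 eta_def] : exists2 eta : R, 0 < eta & 32 * lam * B.+1%:R * eta = kap.
  by apply: quot => //; rewrite -mulrA mulr_gt0.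
have [ep ep_gt0 ep_def] : exists2 ep : R, 0 < ep & 8192 * ep = eta by apply: quot.
have [theta theta_gt0 theta_def] : exists2 theta : R, 0 < theta &
    expR theta = 1 + (4 * B.+1%:R)^-1.
  have c_gt0 : 0 < (4 * B.+1%:R)^-1 :> R by rewrite invr_gt0 mulr_gt0.
  exists (ln (1 + (4 * B.+1%:R)^-1)); first by apply: ln_gt0; rewrite ltrDl.
  by rewrite lnK // posrE addr_gt0.
have te_gt0 : 0 < theta * ep by rewrite mulr_gt0.
have [beta' beta'_gt0 [b1 b2]] := exists_small_multiple te_gt0.
have [beta beta_gt0 beta_def] : exists2 b : R, 0 < b & 4 * lam * b = 2 * d * beta'.
  by apply: quot; rewrite ?mulr_gt0.
have [Cm Cm_gt0 [Cm_def Cm_theta]] : exists2 Cm : R, 0 < Cm &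
    512 <= Cm * (2 * d) * eta /\ 8 <= theta * ep * Cm.
  have [C1 C1_gt0 C1_def] := quot 512 (2 * d * eta) (ltr0n R _) (mulr_gt0 (mulr_gt0 (ltr0n R 2) d_gt0) eta_gt0).
  have [C2 C2_gt0 C2_def] := quot 8 (theta * ep) (ltr0n R _) te_gt0.
  exists (C1 + C2); first by rewrite addr_gt0.
  split; last by rewrite mulrDr C2_def lerDr mulr_ge0 // ltW.
  rewrite -mulrA mulrC mulrDr C1_def lerDl; apply: mulr_ge0; apply: ltW => //.
  by rewrite !mulr_gt0.
(* With [Ct = 1], rounding up the length gives [E <= t k]. *)
exists Cm, 1, beta; split => //.
move=> k reg hk hreg eps eps_gt0.
pose N1 := Num.bound (8 / eps).
exists (maxn (maxn N0 2) N1) => n; rewrite !geq_max => /andP[/andP[nN0 n1] nN1].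
have [sg conn unif [mix mixmin]] := hG n nN0.
have deg_gt0 := connected_deg_gt0 n1 conn.
have /andP[k0 kE] := hk n nN0.
have T0 : (0 < T n)%N.
  rewrite lt0n; apply/eqP => T0; rewrite T0 in mix.
  apply: (mixing_time_gt0 n1 _ mix).
  exact: mixing_radius_lt.
have kR : 0 < (k n)%:R :> R by rewrite ltr0n.
have E_gt0 : 0 < (nedges (adj n))%:R :> R by rewrite ltr0n (leq_trans k0).
have kER : (k n)%:R <= (nedges (adj n))%:R :> R by rewrite ler_nat.
have ln_gt0 : 0 < ln (n%:R : R) by apply: ln_gt0; rewrite ltr1n.
set mR := Cm * _ * _ * _; set tR := 1 * _ / _.
have mR_gt0 : 0 < mR by rewrite !mulr_gt0 // ltr0n.
have tR_ge1 : 1 <= tR by rewrite /tR mul1r ler_pdivlMr ?mul1r.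
have /andP[t1 t2] := ceil_absz_bounds (le_trans ler01 tR_ge1).
have /andP[m1 _] := ceil_absz_bounds (ltW mR_gt0).
set t := absz (Num.ceil tR) in t1 t2 *; set m := absz (Num.ceil mR) in m1 *.
have tRk : tR * (k n)%:R = (nedges (adj n))%:R by rewrite /tR mul1r mulfVK // lt0r_neq0.
(* Since [k n] is at most the number of edges, [tR >= 1], and rounding up at most doubles it. *)
have t_up : t%:R * (k n)%:R <= 2 * (nedges (adj n))%:R :> R.
  have : t%:R * (k n)%:R <= 2 * tR * (k n)%:R
    by rewrite ler_pM2r // (le_trans t2) // mulr_natl mulr2n lerD2l.
  by rewrite -mulrA tRk.
have small_t (a b : R) : 0 <= a -> 2 * a * beta' <= b ->
    a * t%:R * (beta' * (k n)%:R) <= b * (nedges (adj n))%:R.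
  move=> a0 hab; rewrite (_ : a * _ * _ = a * beta' * (t%:R * (k n)%:R)); last by ring.
  apply: (@le_trans _ _ (a * beta' * (2 * (nedges (adj n))%:R))).
    by rewrite ler_wpM2l // mulr_ge0 // ltW.
  rewrite (_ : a * beta' * _ = 2 * a * beta' * (nedges (adj n))%:R); last by ring.
  by rewrite ler_pM2r.
apply: (@le_trans _ _ (1 - 2 * ((1 + expR (- (4 * ln n%:R))) ^+
   (nedges (adj n) + nedges (adj n)) - 1))).
  rewrite lerD2l lerN2; apply: (le_trans (expR_pow_le R n1 (nedges_le (adj n)))).
  rewrite ler_pdivrMr ?ltr0n ?(ltnW n1) // mulrC -ler_pdivrMr //; apply/ltW; apply: lt_le_trans (_ : N1%:R <= _).
    by apply: archi_boundP; rewrite divr_ge0 // ltW.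
  by rewrite ler_nat.
apply: (@graph_recovery R n (adj n) sg deg_gt0 B t m d lam kap eta ep beta beta' theta Cm) => //.
- by apply: (@uniform_mixing _ _ _ sg deg_gt0 (D n) c (T n)) => //; [exact: ltnW|exact: hB].
- by rewrite -(ltr0n R) (lt_le_trans _ t1) // (lt_le_trans ltr01).
- by rewrite -(ltr0n R) (lt_le_trans mR_gt0).
- by rewrite -tRk ler_pM2r.
- rewrite -[leRHS]mul1r; exact: small_t.
- exact: small_t.
- exact: ltW.
(* With [Lam = ln n], the factor [T n >= 1] can be discarded. *)
- apply: le_trans m1; rewrite /mR ler_pM2r // ler_pM2r // ler_peMr ?ler1n //; exact: ltW.
Qed.
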